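(* Let $n \in \mathbb{N}$, $\alpha \in (0,1)$, $T > 0$, and let $f: [0,T] \times \mathbb{R}^n \rightarrow \mathbb{R}^n$ satisfy the following conditions: (f.1) For any $x \in \mathbb{R}^n$, the function $f(\cdot, x)$ is measurable on $[0,T]$. (f.2) For any $r \geqslant 0$, there exists $\lambda_f > 0$ such that $\|f(t,x) - f(t,y)\| \leqslant \lambda_f \|x-y\|$ for all $t \in [0,T]$ and $x, y \in B(r)$. (f.3) There exists $c_f > 0$ such that $\|f(t,x)\| \leqslant (1 + \|x\|) c_f$ for all $t \in [0,T]$ and $x \in \mathbb{R}^n$. Then, for any initial value $x_0 \in \mathbb{R}^n$, there exists a unique solution of the Cauchy problem $$({}^C D^\alpha x)(t) = f(t, x(t)), \quad t \in [0,T], \qquad x(0) = x_0.$$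
   Context: $\mathbb{R}^n$ is the Euclidean space with norm $\|\cdot\|$; $B(r) \subset \mathbb{R}^n$ is the closed ball of radius $r$ centered at the origin. $[0,T]$ carries the Lebesgue measure. $L^\infty([0,T],\mathbb{R}^n)$ is the space of (classes of equivalence of) essentially bounded measurable functions $[0,T] \to \mathbb{R}^n$. Riemann-Liouville fractional integral of order $\alpha \in (0,1)$: $(I^\alpha \varphi)(t) = \frac{1}{\Gamma(\alpha)} \int_0^t \frac{\varphi(\tau)}{(t-\tau)^{1-\alpha}} d\tau$, $t \in [0,T]$, with $\Gamma$ the Euler gamma function. $I^\alpha(L^\infty([0,T],\mathbb{R}^n))$ denotes the set of functions $x:[0,T] \to \mathbb{R}^n$ for which there is $\varphi(\cdot) \in L^\infty([0,T],\mathbb{R}^n)$ with $x(t) = (I^\alpha\varphi)(t)$ for all $t \in [0,T]$. Caputo fractional derivative of order $\alpha$: $({}^C D^\alpha x)(t) = \frac{1}{\Gamma(1-\alpha)} \frac{d}{dt} \int_0^t \frac{x(\tau) - x(0)}{(t-\tau)^\alpha} d\tau$. A function $x: [0,T] \to \mathbb{R}^n$ is called a solution of the Cauchy problem if $x(\cdot) \in \{x_0\} + I^\alpha(L^\infty([0,T],\mathbb{R}^n))$ (i.e., there is $y(\cdot) \in I^\alpha(L^\infty([0,T],\mathbb{R}^n))$ with $x(t) = x_0 + y(t)$ for all $t \in [0,T]$) and the equality $({}^C D^\alpha x)(t) = f(t,x(t))$ holds for almost every $t \in [0,T]$. (The condition $x(0)=x_0$ is then automatic.) *)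

(* Defs.v *)
From mathcomp Require Import all_boot all_order all_algebra.
From mathcomp Require Import all_classical all_reals all_analysis.

Set Implicit Arguments.
Unset Strict Implicit.
Unset Printing Implicit Defensive.
Import Order.TTheory GRing.Theory Num.Theory.
Import numFieldNormedType.Exports.
Local Open Scope classical_set_scope.
Local Open Scope ring_scope.

Section Euclidean.
Variables (R : realType) (n : nat).

(* The norm that the library puts on ['rV[R]_n] is the sup norm. *)
Definition enorm (x : 'rV[R]_n) : R := Num.sqrt (\sum_(i < n) x ord0 i ^+ 2).

Definition eball (r : R) : set 'rV[R]_n := [set x | enorm x <= r].

End Euclidean.

(* [lebesgue_measure] is restricted to the Borel sets; the completed measure is
   defined on all Lebesgue measurable sets, which form the sigma-algebra of the
   domain of the measure, a copy of R. *)
Notation leb R := (@completed_lebesgue_measure R).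
Notation lebT R := (caratheodory_type (wlength (@idfun R))^*%mu).

Section Measurability.
Variables (R : realType) (n : nat).

Definition vmeasurable_fun (D : set R) (f : R -> 'rV[R]_n) : Prop :=
  forall i : 'I_n, measurable_fun (D : set (lebT R)) (fun t : lebT R => f t ord0 i).

(* A representative of an element of L^oo([0, T], R^n); its values outside
   [0, T] are irrelevant. *)
Definition Linfty (T : R) (phi : R -> 'rV[R]_n) : Prop :=
  vmeasurable_fun `[0, T] phi /\
  exists C : R, {ae leb R, forall t : R, t \in `[0, T] -> enorm (phi t) <= C}.

Definition vintegral (D : set R) (f : R -> 'rV[R]_n) : 'rV[R]_n :=
  \row_(i < n) \int[leb R]_(s in D) f s ord0 i.

End Measurability.

Definition Gamma (R : realType) (a : R) : R :=
  \int[leb R]_(s in `]0, +oo[) (s `^ (a - 1) * expR (- s)).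

Section Fractional.
Variables (R : realType) (n : nat) (alpha : R).
Implicit Types x phi : R -> 'rV[R]_n.

Definition RL_integral phi (t : R) : 'rV[R]_n :=
  (Gamma alpha)^-1 *:
    vintegral `[0, t] (fun s => ((t - s) `^ (1 - alpha))^-1 *: phi s).

(* Functions on [0, T] are represented by functions on R, of which only the
   restriction to [0, T] matters. *)
Definition RL_image (T : R) (y : R -> 'rV[R]_n) : Prop :=
  exists2 phi, Linfty T phi & forall t, t \in `[0, T] -> y t = RL_integral phi t.

Definition caputo_primitive x (t : R) : 'rV[R]_n :=
  vintegral `[0, t] (fun s => ((t - s) `^ alpha)^-1 *: (x s - x 0)).

(* Meaningful when [caputo_primitive x] is derivable at t: otherwise [derive1]
   is an unspecified value. For t in ]0, T[ it depends only on x on [0, T]. *)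
Definition caputo_derivative x (t : R) : 'rV[R]_n :=
  (Gamma (1 - alpha))^-1 *: derive1 (caputo_primitive x) t.

Definition cauchy_solution (T : R) (f : R -> 'rV[R]_n -> 'rV[R]_n)
    (x0 : 'rV[R]_n) x : Prop :=
  (exists2 y, RL_image T y & forall t, t \in `[0, T] -> x t = x0 + y t) /\
  {ae leb R, forall t : R, t \in `[0, T] ->
    derivable (caputo_primitive x) t 1 /\ caputo_derivative x t = f t (x t)}.

End Fractional.

(* Main.v *)
Require Import Defs.
From mathcomp Require Import all_boot all_order all_algebra.
From mathcomp Require Import all_classical all_reals all_analysis.
From mathcomp Require Import measurable_realfun ring lra.
Set Implicit Arguments.
Unset Strict Implicit.
Unset Printing Implicit Defensive.
Import Order.TTheory GRing.Theory Num.Theory.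
Import numFieldNormedType.Exports.
Local Open Scope classical_set_scope.
Local Open Scope ring_scope.

(** The Cauchy problem is equivalent to the Volterra equation
    x = x0 + I^alpha (f (., x)) on [0, T], and the latter is solved by Picard
    iteration in sup norms weighted by an exponential.

    Equivalence ([cauchy_solutionP]).  Extended by 0 outside [0, T], a bounded
    function phi has a fractional integral which is the convolution, over the
    whole line, of phi with the kernel u^(alpha - 1) restricted to u > 0
    ([rl_kernel], [rl_conv]).  By Fubini the kernels of orders 1 - alpha and alpha
    compose to the constant Beta (alpha, 1 - alpha) on u > 0 ([rl_kernel_conv]),
    and this constant is Gamma (alpha) * Gamma (1 - alpha) ([eGamma_eBeta]).
    Hence the integral under the derivative sign in the Caputo derivative of
    x0 + I^alpha phi is Gamma (1 - alpha) times a primitive of phi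
    ([caputo_primitiveE]), and the Lebesgue differentiation theorem gives
    that the Caputo derivative is phi almost everywhere ([caputo_derivativeE]).

    Contraction.  The convolution of the kernel of order alpha with e^(lam s) is
    lam^(- alpha) Gamma (alpha) e^(lam t) ([integral_rl_kernel_expR]), so a bound
    |phi (s)| <= M e^(lam s) gives |I^alpha phi (t)| <= M lam^(- alpha) e^(lam t)
    ([RL_integral_le]), with a factor that tends to 0 as lam grows.  With lam
    large, the linear growth of f makes a set |x (t)| <= M e^(lam t) stable
    under the Picard map ([picard_invariant]).  On that set f is Lipschitz, and
    with a second, suitably large weight the map halves distances
    ([RL_contraction]).  The iterates therefore converge geometrically to a fixed
    point ([picard_fixed_point]); two solutions are bounded, so the same
    contraction forces them to coincide.

    All estimates are made coordinate by coordinate: bounds on |v_j| for all j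
    are equivalent, up to a factor n, to bounds on the Euclidean norm
    ([abs_le_enorm], [enorm_le_box]), and the integrals are scalar.
    Measurability is a matter of two sigma-algebras: the solution and the data
    are Lebesgue measurable, while products, Fubini and differentiation are used
    for Borel functions; every Lebesgue measurable function is replaced by an
    almost everywhere equal Borel function ([borel_representative]).  That
    f (t, x (t)) is measurable is Caratheodory's theorem
    ([measurable_caratheodory]). *)

Local Notation mu := lebesgue_measure.

(** * Lebesgue measurable functions and their Borel representatives *)

Section transfer.
Context {R : realType}.
Implicit Types (A D : set R).

Lemma borel_lebesgue_measurable A :
  measurable (A : set (measurableTypeR R)) -> measurable (A : set (lebT R)).
Proof. exact: sub_caratheodory. Qed.

Lemma measurable_id_leb :
  measurable_fun [set: lebT R] (fun t : lebT R => (t : measurableTypeR R)).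
Proof.
by move=> _ B mB; rewrite setTI; exact: borel_lebesgue_measurable.
Qed.

Lemma borel_lebesgue_measurable_fun A (f : R -> R) : measurable A ->
  measurable_fun A f -> measurable_fun (A : set (lebT R)) (fun t : lebT R => f t).
Proof.
by move=> mA mf _ B mB; apply: borel_lebesgue_measurable; exact: mf.
Qed.

Lemma ae_leb_mu (P : R -> Prop) :
  {ae (@mu R), forall t, P t} -> {ae leb R, forall t : R, P t}.
Proof.
move=> [N [mN N0 NP]]; exists N; split => //.
exact: borel_lebesgue_measurable.
Qed.

Lemma lebesgue_measurable_decomp A : measurable (A : set (lebT R)) ->
  exists B N : set R, [/\ measurable B, measurable N, mu N = 0%E &
     B `<=` A /\ A `<=` B `|` N].
Proof.
move=> mA.
have : (completed_algebra_gen (@mu R)) A.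
  rewrite -g_sigma_completed_algebra_genE completed_caratheodory_measurable.
  exact: mA.
move=> [B mB [M [N [mN N0 MN]] BMA]]; exists B, N; split => //; rewrite -BMA.
by split; [exact: subsetUl|exact: setUS].
Qed.

(** The sets {g > q}, q rational, determine [g], and each of them is Borel up to a
    null set.  Setting [g] to 0 on the union of these countably many null sets
    makes it Borel.  The last clause keeps the support and the pointwise bounds
    of [g]. *)
Lemma borel_representative D (g : R -> R) : measurable D ->
  measurable_fun (D : set (lebT R)) (fun t : lebT R => g t) ->
  exists h : R -> R, [/\ measurable_fun [set: R] h,
    {ae leb R, forall t : R, D t -> h t = g t} &
    forall t, h t = 0 \/ (D t /\ h t = g t)].
Proof.
move=> mD mg.
have mgq (q : rat) : measurable (D `&` [set t | ratr q < g t] : set (lebT R)).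
  have := mg (borel_lebesgue_measurable mD) `]ratr q, +oo[%classic.
  rewrite (_ : _ @^-1` _ = [set t | ratr q < g t]); first exact.
  by apply/seteqP; split => t /=; rewrite in_itv/= andbT.
have /choice[B /choice[N BN]] q := lebesgue_measurable_decomp (mgq q).
(* An enumeration of the rationals, so that [M] is a countable union over nat. *)
pose q n : rat := odflt 0 (unpickle n).
have qE r : q (pickle r) = r by rewrite /q pickleK.
pose M := \bigcup_n N (q n).
have mM : measurable M.
  by apply: bigcupT_measurable => n; have [] := BN (q n).
have M0 : mu M = 0%E.
  apply: (measure_negligible (mu := @lebesgue_measure R)) => //.
  apply: negligible_bigcup => n.
  by have [_ mN N0 _] := BN (q n); exists (N (q n)); split.
have mDM : measurable (D `\` M) by exact: measurableD.
have mDMg : measurable_fun (D `\` M) g.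
  apply: (measurability _ (RGenOInfty.measurableE R)) => // _ [_ [x ->] <-].
  rewrite (_ : _ `&` _ =
    \bigcup_n (if x < ratr (q n) then B (q n) `\` M else set0)); last first.
    apply/seteqP; split => t /=.
      rewrite in_itv/= andbT => -[[Dt Mt]] /rat_in_itvoo[r].
      rewrite inE/= => /itvP rxg; exists (pickle r) => //=.
      rewrite qE rxg; split => //.
      have [_ _ _ [_ /(_ t)]] := BN r.
      case=> [|//|Nt]; first by split => //=; rewrite rxg.
      by exfalso; apply: Mt; exists (pickle r) => //; rewrite qE.
    move=> [n _]; case: ifPn => // xq [Bt Mt].
    have [_ _ _ [/(_ t Bt)[Dt /= qg] _]] := BN (q n).
    by rewrite in_itv/= andbT (lt_trans xq qg).
  apply: bigcupT_measurable => n; case: ifPn => // _.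
  by apply: measurableD => //; have [] := BN (q n).
exists (fun t => if t \in D `\` M then g t else 0); split.
- apply: measurable_fun_if => //.
  + by apply: (measurable_fun_bool true); rewrite setTI preimage_mem_true.
  + by rewrite setTI preimage_mem_true.
- exists M; split => //; first exact: borel_lebesgue_measurable.
  move=> t /= /not_implyP[Dt]; apply: contra_notP => Mt.
  by rewrite mem_set.
- move=> t; case: ifPn => [/set_mem[Dt _]|_]; [by right|by left].
Qed.

(** Both integrals agree on Borel functions because the Borel measure is the
    image of its completion under the identity. *)
Lemma integral_leb A (f h : R -> \bar R) : measurable A ->
  measurable_fun (A : set (lebT R)) (fun t : lebT R => f t) ->
  measurable_fun A h ->
  {ae leb R, forall t : R, A t -> f t = h t} ->
  (\int[leb R]_(t in (A : set (lebT R))) f t = \int[mu]_(t in A) h t)%E.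
Proof.
move=> mA mf mh fh.
have mA' := borel_lebesgue_measurable mA.
have mh' : measurable_fun (A : set (lebT R)) (fun t : lebT R => h t).
  by move=> _ B mB; apply: borel_lebesgue_measurable; exact: mh.
rewrite (ae_eq_integral (fun t : lebT R => h t))//.
have int_ge0 (k : R -> \bar R) : measurable_fun A k -> (forall t, 0 <= k t)%E ->
    (\int[leb R]_(t in (A : set (lebT R))) k t = \int[mu]_(t in A) k t)%E.
  move=> mk k0.
  by rewrite -(ge0_integral_pushforward measurable_id_leb).
rewrite integralE [RHS]integralE !int_ge0//.
  exact: measurable_funeneg.
exact: measurable_funepos.
Qed.

End transfer.

(** * Affine substitutions in Lebesgue integrals *)

Section substitution.
Context {R : realType}.
Local Open Scope ereal_scope.

Lemma ge0_integral_oppr (f : R -> \bar R) : measurable_fun [set: R] f ->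
  (forall x, 0 <= f x) -> \int[mu]_x f x = \int[mu]_x f (- x)%R.
Proof.
move=> mf f0.
transitivity (\int[pushforward mu (-%R : R -> measurableTypeR R)]_x f x).
  by apply: eq_measure_integral => //= A mA _; exact/esym/lebesgue_measureN.
by rewrite ge0_integral_pushforward.
Qed.

(** By uniqueness of the Lebesgue measure: the image of the measure under
    x |-> a x + b, scaled by [a], has the right value on intervals. *)
Lemma ge0_integral_affine (f : R -> \bar R) (a b : R) : (0 < a)%R ->
  measurable_fun [set: R] f -> (forall x, 0 <= f x) ->
  \int[mu]_x f x = a%:E * \int[mu]_x f (a * x + b)%R.
Proof.
move=> a0 mf f0.
pose phi (x : measurableTypeR R) : measurableTypeR R := (a * x + b)%R.
have mphi : measurable_fun [set: measurableTypeR R] phi.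
  by apply: measurable_funD => //; exact: measurable_funM.
have a0' : (0 <= a)%R by exact: ltW.
pose c : {nonneg R} := NngNum a0'.
have E A : measurable A -> mu A = mscale c (pushforward mu phi) A.
  move=> mA; apply: lebesgue_measure_unique => //= _ [[u v]] _ <-.
  rewrite /mscale/= /pushforward.
  rewrite (_ : phi @^-1` _ = `](u - b) / a, (v - b) / a]%classic)%R; last first.
    apply/seteqP; split => x /=; rewrite !in_itv/= /phi.
      by rewrite ltr_pdivrMr// ler_pdivlMr// ltrBlDr lerBrDr mulrC.
    by rewrite ltr_pdivrMr// ler_pdivlMr// ltrBlDr lerBrDr mulrC.
  rewrite !lebesgue_measure_itv/= !lte_fin ltr_pM2r ?invr_gt0// ltrD2r.
  case: ifPn => _; last by rewrite mule0.
  by rewrite -!EFinD -EFinM; congr EFin; field; rewrite gt_eqF.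
have /= H := ge0_integral_pushforward mphi mu measurableT mf (fun y _ => f0 y).
rewrite [X in _ * X](_ : _ = \int[mu]_(x in phi @^-1` setT) (f \o phi) x)//.
rewrite -H.
rewrite -(ge0_integral_mscale _ measurableT c)//.
by apply: eq_measure_integral => //= A mA _; exact: (E mphi).
Qed.

End substitution.

(** * The Riemann-Liouville kernel *)

Section kernel.
Context {R : realType}.
Implicit Types (b t u : R).

(** Cutting the power off at 0 turns the integrals over [0, t] of the fractional
    calculus into convolutions over the whole line. *)
Definition rl_kernel b u : R := if 0 < u then u `^ (b - 1) else 0.

Lemma rl_kernel_ge0 b u : 0 <= rl_kernel b u.
Proof. by rewrite /rl_kernel; case: ifP => // _; exact: powR_ge0. Qed.

Lemma measurable_rl_kernel b : measurable_fun [set: R] (rl_kernel b).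
Proof.
by apply: measurable_fun_ifT => //; exact: measurable_fun_ltr.
Qed.

Lemma rl_kernelE b t u : b < 1 -> u <= t ->
  rl_kernel b (t - u) = ((t - u) `^ (1 - b))^-1.
Proof.
move=> b1; rewrite /rl_kernel subr_gt0 le_eqVlt => /predU1P[->|ut].
  by rewrite ltxx subrr powR0 ?invr0// subr_eq0 gt_eqF.
by rewrite ut -powRN opprB.
Qed.

Lemma rl_kernelM b (c u : R) : 0 < c ->
  rl_kernel b (c * u) = c `^ (b - 1) * rl_kernel b u.
Proof.
move=> c0; rewrite /rl_kernel pmulr_rgt0//; case: ifPn => u0; last by rewrite mulr0.
by rewrite powRM// ltW.
Qed.

Lemma GammaE b : Gamma b =
  fine (\int[mu]_u (rl_kernel b u * expR (- u))%:E)%E.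
Proof.
rewrite /Gamma /Rintegral; congr fine.
have mf : measurable_fun (`]0%R, +oo[%classic : set R)
    (fun s : R => (s `^ (b - 1) * expR (- s))%:E).
  apply/measurable_EFinP; apply: measurable_funM.
    by apply: measurable_funTS; apply: measurable_powR.
  by apply/measurable_funTS; apply: measurableT_comp.
rewrite (integral_leb (h := fun s => (s `^ (b - 1) * expR (- s))%:E))//.
- rewrite integral_mkcond; apply: eq_integral => s _.
  rewrite patchE/= /rl_kernel mem_setE in_itv/= andbT.
  by case: ifPn => //; rewrite mul0r.
- by move=> _ B mB; apply: borel_lebesgue_measurable; exact: mf.
- exact: aeW.
Qed.

End kernel.

(** * Gamma and Beta integrals *)

Section gamma_beta.
Context {R : realType}.
Implicit Types (a b lam s t u tau : R).
Local Open Scope ereal_scope.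

(** As an extended real, so that Tonelli applies before finiteness is known. *)
Definition eGamma b : \bar R := \int[mu]_u (rl_kernel b u * expR (- u))%:E.

Definition eBeta a : \bar R :=
  \int[mu]_u (rl_kernel (1 - a) (1 - u) * rl_kernel a u)%:E.

Lemma measurable_rl_kernelB b t :
  measurable_fun [set: R] (fun s => rl_kernel b (t - s)).
Proof.
apply: measurableT_comp; first exact: measurable_rl_kernel.
exact: measurable_funB.
Qed.

Lemma measurable_rl_kernelBr b tau :
  measurable_fun [set: R] (fun s => rl_kernel b (s - tau)).
Proof.
apply: measurableT_comp; first exact: measurable_rl_kernel.
exact: measurable_funB.
Qed.

(** The substitution s = tau + (t - tau) u brings out the power
    1 + (- a) + (a - 1) = 0 of t - tau: the integral depends only on the sign of
    t - tau. *)
Lemma rl_kernel_conv a tau t :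
  \int[mu]_s (rl_kernel (1 - a) (t - s) * rl_kernel a (s - tau))%:E =
  if (tau < t)%R then eBeta a else 0.
Proof.
case: ifPn => [tt|]; last first.
  rewrite -leNgt => tt; apply: integral0_eq => s _.
  rewrite /rl_kernel !subr_gt0; case: ifPn; last by rewrite mul0r.
  case: ifPn; last by rewrite mulr0.
  by move=> /lt_trans /[apply]; rewrite ltNge tt.
have c0 : (0 < t - tau)%R by rewrite subr_gt0.
rewrite (@ge0_integral_affine _ _ (t - tau) tau)//; last 2 first.
- apply/measurable_EFinP; apply: measurable_funM.
    exact: measurable_rl_kernelB.
  exact: measurable_rl_kernelBr.
- by move=> s; rewrite lee_fin mulr_ge0// rl_kernel_ge0.
rewrite -ge0_integralZl_EFin//; last 3 first.
- by move=> s _; rewrite lee_fin mulr_ge0// rl_kernel_ge0.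
- apply/measurable_EFinP; apply: measurable_funM; apply: measurableT_comp.
  + exact: measurable_rl_kernel.
  + by apply: measurable_funB => //; apply: measurable_funD => //; exact: measurable_funM.
  + exact: measurable_rl_kernel.
  + by apply: measurable_funB => //; apply: measurable_funD => //; exact: measurable_funM.
- exact: ltW.
apply: eq_integral => u _; rewrite -EFinM; congr EFin.
rewrite addrK (_ : t - ((t - tau) * u + tau) = (t - tau) * (1 - u))%R; last by ring.
rewrite !rl_kernelM// mulrACA mulrA -powRD; last by rewrite (gt_eqF c0) implybT.
rewrite (_ : 1 - a - 1 + (a - 1) = - 1)%R; last by ring.
by rewrite powR_inv1 ?ltW// -mulrA mulVKf// (gt_eqF c0).
Qed.

Lemma ge0_eGamma b : 0 <= eGamma b.
Proof.
by apply: integral_ge0 => u _; rewrite lee_fin mulr_ge0 ?rl_kernel_ge0 ?expR_ge0.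
Qed.

Lemma ge0_eBeta a : 0 <= eBeta a.
Proof.
by apply: integral_ge0 => u _; rewrite lee_fin mulr_ge0 ?rl_kernel_ge0.
Qed.

Lemma measurable_expRN : measurable_fun [set: R] (fun u : R => expR (- u)).
Proof. by apply: measurableT_comp => //; exact: measurable_expR. Qed.

Lemma eGamma1 : eGamma 1 = 1.
Proof.
transitivity (\int[@lebesgue_measure R]_(u in `]0%R, +oo[) (expR (- u))%:E).
  rewrite [RHS]integral_mkcond; apply: eq_integral => u _.
  rewrite patchE mem_setE in_itv/= andbT /rl_kernel.
  by case: ifPn => _; rewrite ?mul0r// subrr powRr0 mul1r.
rewrite integral_itv_obnd_cbnd; last first.
  by apply/measurable_EFinP; apply: measurable_funTS; exact: measurable_expRN.
rewrite -(integral_exponential_pdf (rate := 1%R))// [LHS]integral_mkcond.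
apply: eq_integral => u _; rewrite /exponential_pdf !patchE.
by case: ifPn => // _; rewrite mul1r mulN1r.
Qed.

(** Write the product as a double integral of
    s^(a - 1) u^(- a) e^(- s - u), substitute u = t - s and integrate in s first:
    the inner integral is the constant [eBeta a], and e^(- t) integrates to 1. *)
Lemma eGamma_eBeta a : eGamma a * eGamma (1 - a) = eBeta a.
Proof.
have mG b : measurable_fun [set: R] (fun u => (rl_kernel b u * expR (- u))%:E).
  apply/measurable_EFinP; apply: measurable_funM; first exact: measurable_rl_kernel.
  exact: measurable_expRN.
have G0 b u : 0 <= (rl_kernel b u * expR (- u))%:E.
  by rewrite lee_fin mulr_ge0 ?rl_kernel_ge0 ?expR_ge0.
pose g (z : R * R) :=
  (expR (- z.2) * (rl_kernel (1 - a) (z.2 - z.1) * rl_kernel a z.1))%:E.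
have g0 z : 0 <= g z.
  by rewrite lee_fin mulr_ge0 ?expR_ge0// mulr_ge0 ?rl_kernel_ge0.
have mg : measurable_fun [set: R * R] g.
  apply/measurable_EFinP; apply: measurable_funM.
    apply: (measurableT_comp measurable_expRN).
    exact: measurable_snd.
  apply: measurable_funM.
    apply: (measurableT_comp (measurable_rl_kernel _)).
    by apply: measurable_funB; [exact: measurable_snd|exact: measurable_fst].
  by apply: (measurableT_comp (measurable_rl_kernel _)); exact: measurable_fst.
rewrite muleC -ge0_integralZl//; last 2 first.
- exact: mG.
- exact: ge0_eGamma.
transitivity (\int[mu]_s \int[mu]_t g (s, t)).
  apply: eq_integral => s _.
  rewrite muleC -ge0_integralZl//; last exact: mG.
  rewrite [RHS](@ge0_integral_affine _ _ 1 s)//; last first.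
    by apply: (measurableT_comp mg); exact: measurable_pair1.
  rewrite mul1e; apply: eq_integral => u _; rewrite /g/= mul1r addrK -EFinM.
  by congr EFin; rewrite opprD expRD; ring.
rewrite (fubini_tonelli (m1 := @lebesgue_measure R) (m2 := @lebesgue_measure R) g)//.
rewrite -[RHS]mule1 -eGamma1 -ge0_integralZl//; last 2 first.
- exact: mG.
- exact: ge0_eBeta.
apply: eq_integral => t _; rewrite /g/=.
under eq_integral do rewrite EFinM.
rewrite ge0_integralZl_EFin//; last 2 first.
- by move=> s _; rewrite lee_fin mulr_ge0 ?rl_kernel_ge0.
- apply/measurable_EFinP; apply: measurable_funM.
    exact: measurable_rl_kernelB.
  exact: measurable_rl_kernel.
have := rl_kernel_conv a 0%R t.
rewrite [X in X = _ -> _](_ : _ =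
  \int[mu]_s (rl_kernel (1 - a) (t - s) * rl_kernel a s)%:E); last first.
  by apply: eq_integral => s _; rewrite subr0.
move=> ->.
rewrite /rl_kernel; case: ifPn => _; last by rewrite mule0 mul0r mule0.
by rewrite subrr powRr0 mul1r muleC.
Qed.

(** The substitution s = t - v / lam reduces to the Gamma integral.  The negative
    power of [lam] is what makes the fractional integral a contraction in a
    weighted norm. *)
Lemma integral_rl_kernel_expR b lam t : (0 < lam)%R ->
  \int[mu]_s (rl_kernel b (t - s) * expR (lam * s))%:E =
  (lam `^ (- b) * expR (lam * t))%:E * eGamma b.
Proof.
move=> lam0.
have mf : measurable_fun [set: R]
    (fun s => (rl_kernel b (t - s) * expR (lam * s))%:E).
  apply/measurable_EFinP; apply: measurable_funM.
    exact: measurable_rl_kernelB.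
  by apply: measurableT_comp; [exact: measurable_expR|exact: measurable_funM].
have f0 c s : 0 <= (rl_kernel b c * expR s)%:E.
  by rewrite lee_fin mulr_ge0 ?rl_kernel_ge0 ?expR_ge0.
rewrite (ge0_integral_affine t ltr01 mf (fun s => f0 _ _)) mul1e.
under eq_integral do rewrite mul1r opprD addrCA subrr addr0.
rewrite ge0_integral_oppr//; last first.
  apply/measurable_EFinP; apply: measurable_funM.
    by apply: (measurableT_comp (measurable_rl_kernel _)).
  apply: measurableT_comp; first exact: measurable_expR.
  by apply: measurable_funM => //; exact: measurable_funD.
under eq_integral do rewrite opprK.
pose g (v : R) := (rl_kernel b v * expR (lam * (- v + t)))%:E.
have g0 v : 0 <= g v by exact: f0.
have mg : measurable_fun [set: R] g.
  apply/measurable_EFinP; apply: measurable_funM; first exact: measurable_rl_kernel.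
  apply: measurableT_comp; first exact: measurable_expR.
  by apply: measurable_funM => //; exact: measurable_funD.
have il0 : (0 < lam^-1)%R by rewrite invr_gt0.
have mg' : measurable_fun [set: R] (fun u => g (lam^-1 * u + 0)%R).
  apply: (measurableT_comp mg).
  by apply: measurable_funD => //; exact: measurable_funM.
rewrite (ge0_integral_affine 0%R il0 mg g0).
rewrite -ge0_integralZl_EFin; last 4 first.
- exact: measurableT.
- by move=> u _; exact: g0.
- exact: mg'.
- exact: ltW.
rewrite -ge0_integralZl_EFin; last 4 first.
- exact: measurableT.
- by move=> u _; exact: f0.
- apply/measurable_EFinP; apply: measurable_funM; first exact: measurable_rl_kernel.
  exact: measurable_expRN.
- by rewrite mulr_ge0 ?powR_ge0 ?expR_ge0.
apply: eq_integral => u _; rewrite /g addr0 -!EFinM; congr EFin.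
rewrite rl_kernelM ?invr_gt0// mulrDr mulrN mulVKf ?gt_eqF// expRD.
have -> : (lam^-1 `^ (b - 1) = lam `^ (- b) * lam)%R.
  rewrite -[in LHS](powR_inv1 (ltW lam0)) -powRrM.
  rewrite -[X in (_ = _ * X)%R](powRr1 (ltW lam0)) -powRD; last by rewrite (gt_eqF lam0) implybT.
  by congr powR; ring.
by field; rewrite (gt_eqF lam0).
Qed.

End gamma_beta.

(** * The Gamma function is finite and positive on the unit interval *)

Section gamma_bounds.
Context {R : realType}.
Implicit Types (b : R).
Local Open Scope ereal_scope.

(** A bound uniform in [e]; the singularity at 0 is then reached by monotone
    convergence. *)
Lemma integral_powR_itv b (e : R) : (0 < b)%R -> (0 < e < 1)%R ->
  \int[mu]_(u in `[e, 1%R]) (u `^ (b - 1))%:E <= b^-1%:E.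
Proof.
move=> b0 /andP[e0 e1].
have dF (a x : R) : (0 < x)%R -> derivable (@powR R ^~ a) x 1.
  by move=> x0; apply: derivable_powR; rewrite in_itv/= x0.
pose F (u : R) : R := (b^-1 * u `^ b)%R.
rewrite (@continuous_FTC2 _ (fun u => u `^ (b - 1))%R F)//.
- rewrite /F -EFinB lee_fin powR1 mulr1 lerBlDr lerDl.
  by rewrite mulr_ge0 ?invr_ge0 ?powR_ge0// ltW.
- apply: derivable_within_continuous => x; rewrite in_itv/= => /andP[ex _].
  by apply: dF; exact: lt_le_trans ex.
- have dG x : (0 < x)%R -> derivable F x 1.
    by move=> x0; apply: derivableM => //; exact: dF.
  have cG x : (0 < x)%R -> {for x, continuous F}.
    by move=> x0; apply/differentiable_continuous/derivable1_diffP/dG.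
  split.
  + by move=> x; rewrite in_itv/= => /andP[ex _]; apply: dG; exact: lt_trans ex.
  + by apply: cvg_at_right_filter; exact: cG.
  + by apply: cvg_at_left_filter; exact: cG.
- move=> x; rewrite in_itv/= => /andP[ex _].
  have x0 : (0 < x)%R by exact: lt_trans ex.
  rewrite derive1Ml; last exact: dF.
  by rewrite powR_derive1 ?in_itv/= ?x0// mulrA mulVf ?mul1r// gt_eqF.
Qed.

(** The integrand is at most u^(b - 1) on ]0, 1] and at most e^(- u) beyond 1. *)
Lemma eGamma_lty b : (0 < b < 1)%R -> eGamma b < +oo.
Proof.
move=> /andP[b0 b1].
have mp : measurable_fun [set: R] (fun u : R => (u `^ (b - 1))%:E).
  by apply/measurable_EFinP; exact: measurable_powR.
have near0 : \int[mu]_(u in `]0%R, 1%R]) (u `^ (b - 1))%:E <= b^-1%:E.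
  pose F (n : nat) : set R := `[(n.+2%:R^-1)%R, 1%R]%classic.
  have UF : `]0%R, 1%R]%classic = \bigcup_n F n.
    apply/seteqP; split => x /=; rewrite ?in_itv/=.
      move=> /andP[x0 x1]; have [n nx] : exists n, (n.+2%:R^-1 < x)%R.
        pose m := Num.trunc x^-1; exists m.
        rewrite invf_plt ?posrE//.
        by rewrite (lt_le_trans (truncnS_gt _))// ler_nat.
      by exists n => //; rewrite /F/= in_itv/= x1 ltW.
    move=> [n _]; rewrite /F/= in_itv/= => /andP[nx ->]; rewrite andbT.
    by apply: lt_le_trans nx; rewrite invr_gt0.
  rewrite UF.
  have cF : \int[mu]_(u in F n) (u `^ (b - 1))%:E @[n --> \oo] -->
      \int[mu]_(u in \bigcup_n F n) (u `^ (b - 1))%:E.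
    apply: ge0_nondecreasing_set_cvg_integral.
    - move=> n m nm; apply/subsetPset => x; rewrite /F/= !in_itv/=.
      move=> /andP[nx ->]; rewrite andbT (le_trans _ nx)//.
      by rewrite lef_pV2 ?posrE// ler_nat !ltnS.
    - by move=> n; exact: measurable_itv.
    - by move=> n; exact: measurable_funTS.
    - by move=> n x _; rewrite lee_fin powR_ge0.
  rewrite -(cvg_lim _ cF)//; apply: lime_le; first by apply/cvg_ex; eexists; exact: cF.
  apply: nearW => n; apply: integral_powR_itv => //.
  by rewrite invr_gt0 ltr0n/= invf_lt1// ltr1n.
apply: (@le_lt_trans _ _ (b^-1%:E + 1)); last by rewrite -EFinD ltry.
rewrite -(@integral_exponential_pdf _ 1%R)//.
have E0 u : 0 <= (exponential_pdf (1 : R) u)%:E.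
  by rewrite lee_fin exponential_pdf_ge0.
have mE := measurable_exponential_pdf (1 : R).
apply: le_trans (leeD near0 (lexx _)).
rewrite integral_mkcond -ge0_integralD//; last 3 first.
- move=> u _; rewrite patchE; case: ifPn => // _; first by rewrite lee_fin powR_ge0.
- by apply/(measurable_restrictT _ _).1 => //; exact: measurable_funTS.
- exact/measurable_EFinP.
apply: ge0_le_integral => //.
- by move=> u _; rewrite lee_fin mulr_ge0 ?rl_kernel_ge0 ?expR_ge0.
- apply/measurable_EFinP; apply: measurable_funM; first exact: measurable_rl_kernel.
  exact: measurable_expRN.
- apply: emeasurable_funD; last exact/measurable_EFinP.
  by apply/(measurable_restrictT _ _).1 => //; exact: measurable_funTS.
move=> u _; rewrite patchE mem_setE in_itv/= /rl_kernel.
case: (ltP 0%R u) => u0 /=; last first.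
  by rewrite mul0r add0e.
have eu : exponential_pdf 1 u = expR (- u).
  by rewrite exponential_pdfE ?ltW// mul1r mulN1r.
case: (leP u 1%R) => u1.
  rewrite -[leLHS]adde0 leeD// lee_fin ler_piMr ?powR_ge0//.
  by rewrite expR_le1 oppr_le0 ltW.
rewrite add0e lee_fin eu ler_piMl ?expR_ge0//.
rewrite -[leRHS](powRr0 u) ler_powR ?(ltW u1)//. by rewrite subr_le0 ltW.
Qed.

(** The integrand is bounded below by a positive constant on [1, 2]. *)
Lemma eGamma_gt0 b : (0 < b < 1)%R -> 0 < eGamma b.
Proof.
move=> /andP[b0 b1].
pose c : R := (2 `^ (b - 1) * expR (- 2))%R.
have c0 : (0 < c)%R by rewrite mulr_gt0 ?powR_gt0 ?expR_gt0.
have G0 u : 0 <= (rl_kernel b u * expR (- u))%:E.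
  by rewrite lee_fin mulr_ge0 ?rl_kernel_ge0 ?expR_ge0.
have mG : measurable_fun [set: R] (fun u => (rl_kernel b u * expR (- u))%:E).
  apply/measurable_EFinP; apply: measurable_funM; first exact: measurable_rl_kernel.
  exact: measurable_expRN.
apply: (@lt_le_trans _ _ (\int[mu]_(u in `[1%R, 2%R : R]) c%:E)).
  rewrite integral_cst//= lebesgue_measure_itv/= lte_fin ltr1n -EFinB -EFinM lte_fin.
  by rewrite mulr_gt0// subr_gt0 ltr1n.
apply: (@le_trans _ _ (\int[mu]_(u in `[1%R, 2%R]) (rl_kernel b u * expR (- u))%:E)).
  apply: ge0_le_integral => //.
  - by move=> u _; rewrite lee_fin ltW.
  - exact: measurable_funTS.
  move=> u /=; rewrite in_itv/= => /andP[u1 u2]; rewrite lee_fin /rl_kernel.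
  have u0 : (0 < u)%R by exact: lt_le_trans u1.
  rewrite u0 ler_pM ?powR_ge0 ?expR_ge0//; last by rewrite ler_expR lerN2.
  rewrite -(opprB 1%R b) !powRN lef_pV2 ?posrE ?powR_gt0//.
  by rewrite ge0_ler_powR// ?nnegrE ?subr_ge0 ?ltW.
apply: ge0_subset_integral => //.
Qed.

End gamma_bounds.

(** * Fractional integrals as convolutions *)

Section convolution.
Context {R : realType}.
Implicit Types (a b lam M t : R) (g : R -> R).

Definition rl_conv b g t : R := \int[mu]_s (rl_kernel b (t - s) * g s).

Lemma fine_eGamma b : fine (eGamma b) = Gamma b.
Proof. by rewrite GammaE. Qed.

Lemma eGamma_fin_num b : 0 < b < 1 -> eGamma b = (Gamma b)%:E.
Proof.
by move=> b01; rewrite -fine_eGamma fineK// ge0_fin_numE ?eGamma_lty ?ge0_eGamma.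
Qed.

Lemma Gamma_gt0 b : 0 < b < 1 -> 0 < Gamma b.
Proof.
by move=> b01; have := eGamma_gt0 b01; rewrite eGamma_fin_num// lte_fin.
Qed.

Variables (b lam M : R) (g : R -> R).
Hypotheses (b01 : 0 < b < 1) (lam0 : 0 < lam) (mg : measurable_fun [set: R] g)
  (gM : forall s, `|g s| <= M * expR (lam * s)).

Let M0 : 0 <= M.
Proof.
by have := le_trans (normr_ge0 _) (gM 0); rewrite mulr0 expR0 mulr1.
Qed.

Lemma measurable_rl_integrand t :
  measurable_fun [set: R] (fun s => rl_kernel b (t - s) * g s).
Proof. by apply: measurable_funM => //; exact: measurable_rl_kernelB. Qed.

Lemma rl_conv_normr_le t :
  (\int[mu]_s `|(rl_kernel b (t - s) * g s)%:E| <=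
     (M * lam `^ (- b) * expR (lam * t) * Gamma b)%:E)%E.
Proof.
apply: (@le_trans _ _
    (\int[mu]_s (M%:E * (rl_kernel b (t - s) * expR (lam * s))%:E))%E).
  apply: ge0_le_integral => //.
  - apply/measurable_EFinP; apply: measurableT_comp => //.
    exact: measurable_rl_integrand.
  - apply/measurable_EFinP; apply: measurable_funM => //; apply: measurable_funM.
      exact: measurable_rl_kernelB.
    by apply: measurableT_comp; [exact: measurable_expR|exact: measurable_funM].
  move=> s _; rewrite -EFinM lee_fin normrM ger0_norm ?rl_kernel_ge0//.
  by rewrite mulrCA ler_wpM2l ?rl_kernel_ge0.
rewrite ge0_integralZl_EFin//; last 2 first.
- by move=> s _; rewrite lee_fin mulr_ge0 ?rl_kernel_ge0 ?expR_ge0.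
- apply/measurable_EFinP; apply: measurable_funM.
    exact: measurable_rl_kernelB.
  by apply: measurableT_comp; [exact: measurable_expR|exact: measurable_funM].
by rewrite integral_rl_kernel_expR// eGamma_fin_num// -!EFinM lee_fin !mulrA.
Qed.

Lemma integrable_rl_integrand t :
  mu.-integrable [set: R] (EFin \o (fun s => rl_kernel b (t - s) * g s)).
Proof.
apply/integrableP; split.
  by apply/measurable_EFinP; exact: measurable_rl_integrand.
exact: le_lt_trans (rl_conv_normr_le t) (ltry _).
Qed.

Lemma EFin_rl_conv t :
  (rl_conv b g t)%:E = (\int[mu]_s (rl_kernel b (t - s) * g s)%:E)%E.
Proof.
rewrite /rl_conv /Rintegral fineK//; apply: integrable_fin_num => //.
exact: integrable_rl_integrand.
Qed.

Lemma rl_conv_le t :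
  `|rl_conv b g t| <= M * lam `^ (- b) * expR (lam * t) * Gamma b.
Proof.
rewrite -lee_fin; apply: le_trans (rl_conv_normr_le t).
rewrite -abse_EFin EFin_rl_conv; apply: le_abse_integral => //.
by apply/measurable_EFinP; exact: measurable_rl_integrand.
Qed.

(** The positive and negative parts are integrals of nonnegative functions of
    two variables, measurable in the parameter by Tonelli. *)
Lemma measurable_rl_conv : measurable_fun [set: R] (rl_conv b g).
Proof.
pose f (z : R * R) : \bar R := (rl_kernel b (z.1 - z.2) * g z.2)%:E.
have mf : measurable_fun [set: R * R] f.
  apply/measurable_EFinP; apply: measurable_funM.
    apply: (measurableT_comp (measurable_rl_kernel _)).
    by apply: measurable_funB; [exact: measurable_fst|exact: measurable_snd].
  by apply: (measurableT_comp mg); exact: measurable_snd.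
apply/measurable_EFinP.
rewrite (_ : _ \o _ =
   (fun t => \int[mu]_s f^\+ (t, s) - \int[mu]_s f^\- (t, s))%E); last first.
  apply/funext => t /=; rewrite EFin_rl_conv integralE.
  by congr (_ - _)%E; apply: eq_integral => s _; rewrite ?funeposE ?funenegE.
have f0 (h : R * R -> \bar R) : measurable_fun [set: R * R] h ->
    (forall z, 0 <= h z)%E -> measurable_fun [set: R] (fun t => \int[mu]_s h (t, s))%E.
  move=> mh h0.
  exact: (measurable_fun_fubini_tonelli_F (m2 := @lebesgue_measure R) h mh h0).
apply: emeasurable_funB; apply: f0 => //.
  exact: measurable_funepos.
exact: measurable_funeneg.
Qed.

End convolution.

(** * Composition of fractional integrals of complementary orders *)

Section composition.
Context {R : realType}.

(** Fubini moves the integration in the intermediate variable inside, where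
    [rl_kernel_conv] makes it constant.  Absolute integrability comes from
    applying the exponential bound twice. *)
Lemma rl_conv_comp (a lam M t : R) (g : R -> R) : 0 < a < 1 -> 0 < lam ->
  mu.-integrable [set: R] (EFin \o g) -> (forall s, `|g s| <= M * expR (lam * s)) ->
  rl_conv (1 - a) (rl_conv a g) t =
  Gamma a * Gamma (1 - a) * \int[mu]_(s in `]-oo, t]) g s.
Proof.
move=> a01 lam0 ig gM.
have mg : measurable_fun [set: R] g.
  by apply/measurable_EFinP; exact: measurable_int ig.
have a01' : 0 < 1 - a < 1 by lra.
have M0 : 0 <= M.
  by have := le_trans (normr_ge0 _) (gM 0); rewrite mulr0 expR0 mulr1.
pose f (z : R * R) : \bar R :=
  (rl_kernel (1 - a) (t - z.1) * (rl_kernel a (z.1 - z.2) * g z.2))%:E.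
have mf : measurable_fun [set: R * R] f.
  apply/measurable_EFinP; apply: measurable_funM.
    apply: (measurableT_comp (measurable_rl_kernel _)).
    by apply: measurable_funB => //; exact: measurable_fst.
  apply: measurable_funM.
    apply: (measurableT_comp (measurable_rl_kernel _)).
    by apply: measurable_funB; [exact: measurable_fst|exact: measurable_snd].
  by apply: (measurableT_comp mg); exact: measurable_snd.
have mconv := measurable_rl_conv a01 lam0 mg gM.
have convM s : `|rl_conv a g s| <= (M * lam `^ (- a) * Gamma a) * expR (lam * s).
  by rewrite mulrAC; exact: rl_conv_le.
have intf : (@lebesgue_measure R \x @lebesgue_measure R)%E.-integrable setT f.
  apply/integrable12ltyP => //.
  apply: (@le_lt_trans _ _ (\int[mu]_s ((M * lam `^ (- a) * Gamma a)%:E *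
     (rl_kernel (1 - a) (t - s) * expR (lam * s))%:E))%E); last first.
    rewrite ge0_integralZl_EFin//; last 3 first.
    - by move=> s _; rewrite lee_fin mulr_ge0 ?rl_kernel_ge0 ?expR_ge0.
    - apply/measurable_EFinP; apply: measurable_funM.
        exact: measurable_rl_kernelB.
      by apply: measurableT_comp; [exact: measurable_expR|exact: measurable_funM].
    - by rewrite !mulr_ge0 ?powR_ge0// ltW// Gamma_gt0.
    by rewrite integral_rl_kernel_expR// eGamma_fin_num// -!EFinM ltry.
  apply: ge0_le_integral => //.
  - by move=> s _; exact: integral_ge0.
  - have mf' : measurable_fun [set: R * R] (abse \o f) by exact: measurableT_comp.
    apply: (measurable_fun_fubini_tonelli_F (m2 := @lebesgue_measure R) _ mf').
    by move=> z; exact: abse_ge0.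
  - apply/measurable_EFinP; apply: measurable_funM => //; apply: measurable_funM.
      exact: measurable_rl_kernelB.
    by apply: measurableT_comp; [exact: measurable_expR|exact: measurable_funM].
  move=> s _.
  rewrite (_ : (\int[mu]_y `|f (s, y)|)%E =
     ((rl_kernel (1 - a) (t - s))%:E * \int[mu]_y `|(rl_kernel a (s - y) * g y)%:E|)%E).
    rewrite -EFinM mulrCA EFinM lee_wpmul2l// ?lee_fin ?rl_kernel_ge0//.
    apply: le_trans (rl_conv_normr_le a01 lam0 mg gM s) _.
    by rewrite lee_fin mulrAC.
  rewrite -ge0_integralZl_EFin ?rl_kernel_ge0//; last first.
    apply/measurable_EFinP; apply: measurableT_comp => //.
    exact: measurable_rl_integrand.
  apply: eq_integral => y _; rewrite /f/= -EFinM normrM.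
  by rewrite (ger0_norm (rl_kernel_ge0 _ _)).
apply: EFin_inj; rewrite (EFin_rl_conv a01' lam0 mconv convM).
transitivity (\int[mu]_s \int[mu]_y f (s, y))%E.
  apply: eq_integral => s _; rewrite EFinM (EFin_rl_conv a01 lam0 mg gM).
  rewrite -integralZl//; exact: (integrable_rl_integrand a01 lam0 mg gM).
rewrite (Fubini intf).
have eB : eBeta a = (Gamma a * Gamma (1 - a))%:E.
  by rewrite -eGamma_eBeta !eGamma_fin_num// EFinM.
transitivity (\int[mu]_y (((Gamma a * Gamma (1 - a))%:E *
    ((g \_ `]-oo, t[) y)%:E)))%E.
  apply: eq_integral => y _.
  transitivity ((g y)%:E * \int[mu]_s
      (rl_kernel (1 - a) (t - s) * rl_kernel a (s - y))%:E)%E.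
    rewrite -integralZl//; first by apply: eq_integral => s _; rewrite -EFinM/=; congr EFin; ring.
    apply/integrableP; split.
      apply/measurable_EFinP; apply: measurable_funM.
        exact: measurable_rl_kernelB.
      exact: measurable_rl_kernelBr.
    under eq_integral do rewrite /= ger0_norm ?mulr_ge0 ?rl_kernel_ge0//.
    by rewrite rl_kernel_conv; case: ifPn; rewrite ?eB ltry.
  rewrite rl_kernel_conv patchE mem_setE in_itv/= eB.
  by case: ifPn => _; rewrite ?mule0// muleC.
have intg (x : bool) : mu.-integrable [set` Interval -oo%O (BSide x t)] (EFin \o g).
  by apply: integrableS ig => //; exact: measurable_itv.
rewrite integralZl//; last first.
  rewrite (_ : (fun y => _) = (EFin \o g) \_ `]-oo, t[); last first.
    by apply/funext => y; rewrite restrict_EFin.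
  have mI : measurable (`]-oo, t[%classic : set (measurableTypeR R)) by exact: measurable_itv.
  exact: ((integrable_mkcond _ mI).1 (intg true)).
rewrite [RHS]EFinM; congr (_ * _)%E.
rewrite /Rintegral fineK; last exact: integrable_fin_num.
rewrite -integral_itv_bndo_bndc; last by apply/measurable_EFinP; exact: measurable_funTS.
by rewrite [RHS]integral_mkcond; apply: eq_integral => y _; rewrite restrict_EFin.
Qed.

End composition.

(** * Fractional integrals of essentially bounded functions *)

Section ae_leb.
Context {R : realType}.
Implicit Types (P Q S : R -> Prop).

#[local] Instance ae_leb_filter : Filter (almost_everywhere (leb R)).
Proof. exact: ae_filter_ringOfSetsType. Qed.

Lemma ae_leb_impl P Q : (forall t, P t -> Q t) ->
  {ae leb R, forall t : R, P t} -> {ae leb R, forall t : R, Q t}.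
Proof. exact: (@filterS _ (almost_everywhere (leb R))). Qed.

Lemma ae_leb_impl2 P Q S : (forall t, P t -> Q t -> S t) ->
  {ae leb R, forall t : R, P t} -> {ae leb R, forall t : R, Q t} ->
  {ae leb R, forall t : R, S t}.
Proof. exact: (@filterS2 _ (almost_everywhere (leb R))). Qed.

Lemma ae_leb_forall (I : finType) (P : I -> R -> Prop) :
  (forall i, {ae leb R, forall t : R, P i t}) ->
  {ae leb R, forall t : R, forall i, P i t}.
Proof. exact: (@filter_forall _ I P (almost_everywhere (leb R))). Qed.

End ae_leb.

Section representative.
Context {R : realType}.
Variables (T : R).
Implicit Types (g h w : R -> R).

(** Extension by 0 lets [rl_conv] integrate over the whole line. *)
Definition representative g h : Prop :=
  [/\ measurable_fun [set: R] h, (forall s, s \notin `[0, T] -> h s = 0) &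
      {ae leb R, forall s : R, s \in `[0, T] -> h s = g s}].

(** A bound that holds almost everywhere for [g] is made to hold everywhere by
    setting the representative to 0 where it fails. *)
Lemma bounded_representative w g :
  measurable_fun [set: R] w -> (forall s, 0 <= w s) ->
  measurable_fun (`[0, T]%classic : set (lebT R)) (fun t : lebT R => g t) ->
  {ae leb R, forall s : R, s \in `[0, T] -> `|g s| <= w s} ->
  exists2 h, representative g h & forall s, `|h s| <= w s.
Proof.
move=> mw w0 mg gw.
have [h [mh hg h0]] := borel_representative (measurable_itv _) mg.
exists (fun s => if `|h s| <= w s then h s else 0); last first.
  by move=> s; case: ifPn => // _; rewrite normr0.
split.
- apply: measurable_fun_ifT => //.
  apply: measurable_fun_ler => //; exact: measurableT_comp.
- move=> s sT; case: (h0 s) => [->|[]]; first by case: ifP.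
  by rewrite /= (negbTE sT).
- move: gw hg; apply: ae_leb_impl2 => s /= gw hg sT.
  by rewrite hg// gw.
Qed.

Lemma measurable_expR_weight (M lam : R) :
  measurable_fun [set: R] (fun s => M * expR (lam * s)).
Proof.
apply: measurable_funM => //; apply: measurableT_comp.
  exact: measurable_expR.
exact: measurable_funM.
Qed.

Lemma integrable_representative (C : R) g h : representative g h ->
  (forall s, `|h s| <= C * expR (1 * s)) -> mu.-integrable [set: R] (EFin \o h).
Proof.
move=> [mh h0 _] hC.
have mT : measurable (`[0, T]%classic : set (measurableTypeR R)).
  exact: measurable_itv.
rewrite (_ : EFin \o h = (EFin \o h) \_ `[0, T]); last first.
  apply/funext => s; rewrite patchE mem_setE; case: ifPn => // sT.
  by rewrite /= h0.
apply: (integrable_mkcond _ mT).1.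
apply: measurable_bounded_integrable => //.
- by rewrite /= lebesgue_measure_itv/=; case: ifPn => _; rewrite ?ltry.
- exact: measurable_funTS.
have C0 : 0 <= C.
  by have := le_trans (normr_ge0 _) (hC 0); rewrite mulr0 expR0 mulr1.
exists (C * expR T); split; first exact: num_real.
move=> x Cx s /=; rewrite in_itv/= => /andP[_ sT].
rewrite (le_trans (hC s))// (le_trans _ (ltW Cx))// mul1r.
by rewrite ler_wpM2l// ler_expR.
Qed.

Lemma integral_leb_representative g h (k : R -> R) (t : R) :
  representative g h -> 0 <= t <= T ->
  measurable_fun (`[0, T]%classic : set (lebT R)) (fun t : lebT R => g t) ->
  measurable_fun [set: R] k ->
  \int[leb R]_(s in `[0, t]) (k s * g s) = \int[mu]_(s in `[0, t]) (k s * h s).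
Proof.
move=> [mh h0 hg] /andP[t0 tT] mg mk; congr fine.
have sub : `[0, t]%classic `<=` (`[0, T]%classic : set R).
  by apply: subset_itvl; rewrite bnd_simp.
apply: integral_leb => //.
- apply/measurable_EFinP; apply: measurable_funM.
    by apply: borel_lebesgue_measurable_fun => //; exact: measurable_funTS.
  apply: measurable_funS mg => //; exact: borel_lebesgue_measurable.
- by apply/measurable_EFinP/measurable_funTS; exact: measurable_funM.
- move: hg; apply: ae_leb_impl => s /= hg st; congr (_ * _)%:E.
  by apply/esym/hg/sub.
Qed.

Lemma representativeB g1 g2 h1 h2 : representative g1 h1 ->
  representative g2 h2 -> representative (g1 \- g2) (h1 \- h2).
Proof.
move=> [mh1 h10 e1] [mh2 h20 e2]; split.
- exact: measurable_funB.
- by move=> s sT; rewrite /= h10// h20// subr0.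
- by move: e1 e2; apply: ae_leb_impl2 => s /= e1 e2 sT; rewrite e1 ?e2.
Qed.

End representative.

Section RL.
Context {R : realType} {n : nat}.
Variables (alpha T : R).
Hypotheses (alpha01 : 0 < alpha < 1) (T0 : 0 < T).
Implicit Types (phi psi : R -> 'rV[R]_n) (g h : R -> R) (M lam : R).

Lemma abs_le_enorm (x : 'rV[R]_n) i : `|x ord0 i| <= enorm x.
Proof.
rewrite /enorm -sqrtr_sqr ler_sqrt ?sumr_ge0//; last by move=> j _; rewrite sqr_ge0.
by rewrite (bigD1 i)//= lerDl sumr_ge0// => j _; rewrite sqr_ge0.
Qed.

Lemma enorm_le_sum (x : 'rV[R]_n) : enorm x <= \sum_i `|x ord0 i|.
Proof.
set S := \sum_i _; have S0 : 0 <= S by exact: sumr_ge0.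
rewrite /enorm -(ger0_norm S0) -sqrtr_sqr ler_wsqrtr// expr2 {1}/S mulr_suml.
apply: ler_sum => i _; rewrite -[leLHS]real_normK ?num_real// expr2.
by rewrite ler_wpM2l// /S (bigD1 i)//= lerDl sumr_ge0.
Qed.

Lemma rl_conv_itv g h (b t : R) : representative T g h -> 0 < b < 1 ->
  rl_conv b h t = \int[mu]_(s in `[0, t]) (((t - s) `^ (1 - b))^-1 * h s).
Proof.
move=> [mh h0 _] /andP[b0 b1].
rewrite [RHS]Rintegral_mkcond; apply: eq_Rintegral => s _.
rewrite patchE mem_setE in_itv/=.
have [s0 /=|s0/=] := leP 0 s; last by rewrite h0 ?mulr0// in_itv/= leNgt s0.
have [st|ts] := leP s t; first by rewrite rl_kernelE.
by rewrite /rl_kernel subr_gt0 ltNge (ltW ts) mul0r.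
Qed.

Lemma RL_integralE phi i h t : t \in `[0, T] ->
  vmeasurable_fun `[0, T] phi -> representative T (fun s => phi s ord0 i) h ->
  RL_integral alpha phi t ord0 i = (Gamma alpha)^-1 * rl_conv alpha h t.
Proof.
rewrite in_itv/= => tT mphi rh; rewrite /RL_integral /vintegral !mxE; congr (_ * _).
rewrite (rl_conv_itv _ rh)//.
under eq_Rintegral do rewrite mxE.
apply: (integral_leb_representative rh) => //.
under eq_fun do rewrite -powRN.
by apply: (measurableT_comp (measurable_powR _)); exact: measurable_funB.
Qed.

Lemma weight_representative M lam phi i : 0 <= M -> vmeasurable_fun `[0, T] phi ->
  {ae leb R, forall s : R, s \in `[0, T] -> `|phi s ord0 i| <= M * expR (lam * s)} ->
  exists2 h, representative T (fun s => phi s ord0 i) h &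
    forall s, `|h s| <= M * expR (lam * s).
Proof.
move=> M0 mphi phiM; apply: bounded_representative => //.
- exact: measurable_expR_weight.
- by move=> s; rewrite mulr_ge0 ?expR_ge0.
Qed.

Lemma Linfty_representative phi : Linfty T phi -> exists2 C : R, 0 <= C &
  forall i, exists2 h, representative T (fun s => phi s ord0 i) h &
    forall s, `|h s| <= C * expR (1 * s).
Proof.
move=> [mphi [C phiC]]; exists `|C| => // i; apply: weight_representative => //.
move: phiC; apply: ae_leb_impl => s sC sT.
rewrite (le_trans (abs_le_enorm _ _))// (le_trans (sC sT))//.
rewrite (le_trans (ler_norm _))// ler_peMr// mul1r -expR0 ler_expR.
by move: sT; rewrite in_itv/= => /andP[].
Qed.

Lemma measurable_RL_integral phi : Linfty T phi ->
  vmeasurable_fun `[0, T] (RL_integral alpha phi).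
Proof.
move=> Lphi; have [C C0 hC] := Linfty_representative Lphi.
move=> i; have [h rh hCi] := hC i.
apply: (@eq_measurable_fun _ _ _ _ _
   (fun t : lebT R => (Gamma alpha)^-1 * rl_conv alpha h t)).
  by move=> t tT; rewrite (RL_integralE (set_mem tT) Lphi.1 rh).
apply: borel_lebesgue_measurable_fun => //; apply: measurable_funTS.
apply: measurable_funM => //; have [mh _ _] := rh.
exact: (measurable_rl_conv alpha01 _ mh hCi).
Qed.

(** The convolution of the kernel with M e^(lam s) dominates, and the two Gamma
    factors cancel. *)
Lemma RL_integral_le M lam phi i t : 0 <= M -> 0 < lam -> t \in `[0, T] ->
  vmeasurable_fun `[0, T] phi ->
  {ae leb R, forall s : R, s \in `[0, T] -> `|phi s ord0 i| <= M * expR (lam * s)} ->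
  `|RL_integral alpha phi t ord0 i| <= M * lam `^ (- alpha) * expR (lam * t).
Proof.
move=> M0 lam0 tT mphi phiM.
have [h rh hM] := weight_representative M0 mphi phiM.
have [mh _ _] := rh; have G0 := Gamma_gt0 alpha01.
rewrite (RL_integralE tT mphi rh) normrM normfV (gtr0_norm G0).
by rewrite ler_pdivrMl// mulrC; exact: rl_conv_le.
Qed.

Lemma RL_integralB phi psi t i : Linfty T phi -> Linfty T psi -> t \in `[0, T] ->
  RL_integral alpha phi t ord0 i - RL_integral alpha psi t ord0 i =
  RL_integral alpha (fun s => phi s - psi s) t ord0 i.
Proof.
move=> Lphi Lpsi tT.
have [C C0 /(_ i)[h rh hC]] := Linfty_representative Lphi.
have [D D0 /(_ i)[k rk kD]] := Linfty_representative Lpsi.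
have [mh _ _] := rh; have [mk _ _] := rk.
have rhk := representativeB rh rk.
rewrite (RL_integralE tT Lphi.1 rh) (RL_integralE tT Lpsi.1 rk).
rewrite (RL_integralE tT (h := h \- k)); last 2 first.
- move=> j; apply: (@eq_measurable_fun _ _ _ _ _
    (fun t : lebT R => phi t ord0 j - psi t ord0 j)).
    by move=> s _; rewrite !mxE.
  by apply: measurable_funB; [exact: Lphi.1|exact: Lpsi.1].
- case: rhk => m0 z e; split => //; move: e; apply: ae_leb_impl => s e sT.
  by rewrite !mxE e.
rewrite -mulrBr; congr (_ * _); rewrite /rl_conv -RintegralB//.
- by apply: eq_Rintegral => s _; rewrite mulrBr.
- exact: (integrable_rl_integrand alpha01 _ mh hC).
- exact: (integrable_rl_integrand alpha01 _ mk kD).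
Qed.

End RL.

(** * The Caputo derivative of a fractional integral *)

Section caputo.
Context {R : realType} {n : nat}.
Variables (alpha T : R).
Hypotheses (alpha01 : 0 < alpha < 1) (T0 : 0 < T).
Implicit Types (x phi : R -> 'rV[R]_n) (h : R -> R).

(** The convolution vanishes at 0, so that x s - x 0 is itself a fractional
    integral, to which [rl_conv_comp] applies. *)
Lemma caputo_primitiveE x phi (x0 : 'rV[R]_n) i h t : Linfty T phi ->
  (forall t, t \in `[0, T] -> x t = x0 + RL_integral alpha phi t) ->
  representative T (fun s => phi s ord0 i) h ->
  mu.-integrable [set: R] (EFin \o h) ->
  (exists C, forall s, `|h s| <= C * expR (1 * s)) ->
  t \in `[0, T] ->
  caputo_primitive alpha x t ord0 i =
  Gamma (1 - alpha) * \int[mu]_(s in `]-oo, t]) h s.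
Proof.
move=> Lphi xE rh ih [C hC] tT.
have [mh h0 _] := rh.
have G0 := Gamma_gt0 alpha01.
have alpha01' : 0 < 1 - alpha < 1 by rewrite subr_gt0 gtrBl andbC.
have conv0 s : s <= 0 -> rl_conv alpha h s = 0.
  move=> s0; rewrite /rl_conv [RHS](_ : 0 = \int[@lebesgue_measure R]_s 0).
    apply: eq_Rintegral => u _; rewrite /rl_kernel subr_gt0.
    case: ifPn => us; last by rewrite mul0r.
    by rewrite h0 ?mulr0// in_itv/= leNgt (lt_le_trans us s0).
  by rewrite Rintegral_cst// mul0r.
have xiE s : s \in `[0, T] -> x s ord0 i - x 0 ord0 i = (Gamma alpha)^-1 * rl_conv alpha h s.
  move=> sT; have zT : 0 \in `[0, T] by rewrite in_itv/= lexx ltW.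
  have xi u : u \in `[0, T] ->
      x u ord0 i = x0 ord0 i + (Gamma alpha)^-1 * rl_conv alpha h u.
    by move=> uT; rewrite (xE u uT) mxE (RL_integralE alpha01 uT Lphi.1 rh).
  rewrite (xi s sT) (xi 0 zT).
  by rewrite (conv0 0)// mulr0 addr0 addrAC subrr add0r.
pose k s := (Gamma alpha)^-1 * rl_conv alpha h s.
have mk : measurable_fun [set: R] k.
  by apply: measurable_funM => //; exact: (measurable_rl_conv alpha01 _ mh hC).
rewrite /caputo_primitive /vintegral mxE.
transitivity (rl_conv (1 - alpha) k t).
  rewrite /rl_conv [RHS](_ : _ =
      \int[mu]_(s in `[0, t]) (((t - s) `^ alpha)^-1 * k s)); last first.
    rewrite [RHS]Rintegral_mkcond; apply: eq_Rintegral => s _.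
    rewrite patchE mem_setE in_itv/=.
    have [s0 /=|s0/=] := leP 0 s; last by rewrite /k conv0 ?mulr0// ltW.
    have [st|ts] := leP s t; last by rewrite /rl_kernel subr_gt0 ltNge (ltW ts) mul0r.
    by rewrite rl_kernelE ?subKr//; case/andP: alpha01'.
  have sub : `[0, t]%classic `<=` (`[0, T]%classic : set R).
    by move: tT; rewrite in_itv/= => /andP[_ tT]; apply: subset_itvl; rewrite bnd_simp.
  have mf : measurable_fun (`[0, t]%classic : set R)
      (fun s => (((t - s) `^ alpha)^-1 * k s)%:E).
    apply/measurable_EFinP/measurable_funTS/measurable_funM => //.
    under eq_fun do rewrite -powRN.
    by apply: (measurableT_comp (measurable_powR _)); exact: measurable_funB.
  have E s : `[0, t]%classic s ->
      ((((t - s) `^ alpha)^-1 *: (x s - x 0)) ord0 i)%:E =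
      (((t - s) `^ alpha)^-1 * k s)%:E.
    by move=> /sub sT; rewrite !mxE xiE.
  congr fine; apply: integral_leb => //; last exact: aeW.
  apply: (@eq_measurable_fun _ _ _ _ _
     (fun s : lebT R => (((t - s) `^ alpha)^-1 * k s)%:E)).
    by move=> s; rewrite inE => /E ->.
  by move=> _ B mB; apply: borel_lebesgue_measurable; exact: mf.
have -> : rl_conv (1 - alpha) k t = (Gamma alpha)^-1 * rl_conv (1 - alpha) (rl_conv alpha h) t.
  rewrite /rl_conv -RintegralZl//.
    by apply: eq_Rintegral => s _; rewrite mulrCA.
  apply: (integrable_rl_integrand alpha01' ltr01 (M := C * 1 `^ (- alpha) * Gamma alpha)).
    exact: (measurable_rl_conv alpha01 _ mh hC).
  by move=> s; rewrite mulrAC; exact: rl_conv_le.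
by rewrite (rl_conv_comp _ alpha01 ltr01 ih hC) !mulrA mulVf ?mul1r// gt_eqF.
Qed.

(** [caputo_primitiveE] holds near every point of ]0, T[, so the differentiation
    theorem for integrals applies there; the end points form a null set. *)
Lemma caputo_derivativeE x phi (x0 : 'rV[R]_n) : Linfty T phi ->
  (forall t, t \in `[0, T] -> x t = x0 + RL_integral alpha phi t) ->
  {ae leb R, forall t : R, t \in `[0, T] ->
    derivable (caputo_primitive alpha x) t 1 /\ caputo_derivative alpha x t = phi t}.
Proof.
move=> Lphi xE.
have [C C0 repr] := Linfty_representative Lphi.
have /choice[h hP] : forall i, exists h, representative T (fun s => phi s ord0 i) h /\
    forall s, `|h s| <= C * expR (1 * s).
  by move=> i; have [h rh hC] := repr i; exists h.
have G0' : 0 < Gamma (1 - alpha) by apply: Gamma_gt0; rewrite subr_gt0 gtrBl andbC.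
have ih i : mu.-integrable [set: R] (EFin \o h i).
  by have [rh hC] := hP i; exact: integrable_representative rh hC.
pose H i t := \int[mu]_(s in `]-oo, t]) h i s.
have ftc i : {ae leb R, forall t : R, derivable (H i) t 1 /\ derive1 (H i) t = h i t}.
  apply: ae_leb_mu; apply: FTC1Ny.
    by move=> y; apply: integrableS (ih i) => //; exact: measurable_itv.
  by apply: open_integrable_locally => //; exact: openT.
have eqh i : {ae leb R, forall s : R, s \in `[0, T] -> h i s = phi s ord0 i}.
  by have [[]] := hP i.
(* At the end points [caputo_primitiveE] is available on one side only. *)
have ends : {ae leb R, forall t : R, t != 0 /\ t != T}.
  apply: ae_leb_mu; exists ([set 0] `|` [set T]); split.
  - exact: measurableU.
  - have s1 a : @lebesgue_measure R [set a] = 0%E by exact: lebesgue_measure_set1.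
    by rewrite measureU0; [exact: s1|exact: measurable_set1|exact: measurable_set1|exact: s1].
  - move=> t /= /not_andP[|] /negP; rewrite negbK => /eqP ->; by [left|right].
move: (ae_leb_forall ftc) (ae_leb_forall eqh) => ftc' eqh'.
move: (ae_leb_impl2 (fun t a b => conj a b) ftc' eqh') ends.
apply: ae_leb_impl2 => t [{}ftc' {}eqh'] [t0 tT] tT'.
have t0T : t \in `]0, T[ by move: tT'; rewrite !in_itv/= !lt_neqAle eq_sym t0 tT.
have nearE i : {near t, (fun u => Gamma (1 - alpha) * H i u) =1
    (fun u => caputo_primitive alpha x u ord0 i)}.
  near=> u; have uT : u \in `[0, T].
    by apply: subset_itv_oo_cc; near: u; exact: near_in_itvoo.
  have [rh hC] := hP i.
  by rewrite (caputo_primitiveE Lphi xE rh (ih i) (ex_intro _ C hC)).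
have dH i : derivable (fun u => Gamma (1 - alpha) * H i u) t 1.
  by apply: derivableM => //; have [] := ftc' i.
have dcp : derivable (caputo_primitive alpha x) t 1.
  apply/derivable_mxP => j i; rewrite ord1.
  by apply: near_eq_derivable (dH i); exact: nearE.
split => //; rewrite /caputo_derivative derive1E derive_mx//.
apply/rowP => i; rewrite !mxE -(near_eq_derive _ (nearE i)).
rewrite -derive1E derive1Ml; last by have [] := ftc' i.
by have [_ ->] := ftc' i; rewrite eqh'// mulKf// gt_eqF.
Unshelve. all: by end_near. Qed.

End caputo.

(** * Composition with Caratheodory functions *)

Section caratheodory_function.
Context d {X : measurableType d} {R : realType} {n : nat}.
Implicit Types (x : X -> 'rV[R]_n) (F : X -> 'rV[R]_n -> R) (D : set X).

Let grid (k : nat) (m : 'rV[int]_n) : 'rV[R]_n :=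
  \row_j ((m ord0 j)%:~R / k.+1%:R).

(** The cells of side 1 / (k + 1) are indexed by integer vectors, a countable
    type; [grid k (cell k v)] is the lower corner of the cell containing [v]. *)
Let cell (k : nat) (v : 'rV[R]_n) : 'rV[int]_n :=
  \row_j Num.floor (v ord0 j * k.+1%:R).

Let grid_cell_cvg v : grid k (cell k v) @[k --> \oo] --> v.
Proof.
apply/cvg_ballP => e e0; near=> k; split => // i j; rewrite ord1 /= !mxE.
set a := v ord0 j; have k0 : (0 : R) < k.+1%:R by [].
have /andP[lo hi] := floor_itv (a * k.+1%:R).
rewrite /ball/= ltr_norml; apply/andP; split.
  rewrite (lt_le_trans (y := 0)) ?oppr_lt0// subr_ge0.
  by rewrite ler_pdivrMr.
rewrite -(ltr_pM2r k0) mulrBl divfK ?gt_eqF//.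
have ek : 1 < e * k.+1%:R.
  rewrite -ltr_pdivrMr// mul1r.
  by near: k; exact: (near_infty_natSinv_lt (PosNum e0)).
by move: hi; rewrite rmorphD/=; lra.
Unshelve. all: by end_near. Qed.

(** Approximate [x] by functions with countably many values, on the level sets
    of which F (t, x (t)) is measurable in t; continuity of F (t, .) at x (t)
    passes to the limit. *)
Lemma measurable_caratheodory D F x : measurable D ->
  (forall v, measurable_fun D (F ^~ v)) ->
  (forall j, measurable_fun D (fun t => x t ord0 j)) ->
  (forall t, D t -> {for x t, continuous (F t)}) ->
  measurable_fun D (fun t => F t (x t)).
Proof.
move=> mD mF mx cF.
apply: (measurable_fun_cvg (h := fun k t => F t (grid k (cell k (x t))))); last first.
  by move=> t Dt; apply: continuous_cvg; [exact: cF|exact: grid_cell_cvg].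
move=> k _ B mB.
have mcell m : measurable (D `&` [set t | cell k (x t) = m]).
  rewrite (_ : _ `&` _ = \bigcap_(j in [set: 'I_n]) (D `&`
      (fun t => x t ord0 j * k.+1%:R) @^-1`
      `[(m ord0 j)%:~R, (m ord0 j + 1)%:~R[) `&` D); last first.
    apply/seteqP; split => t /=.
      move=> [Dt <-]; split => // j _; split => //=.
      by rewrite in_itv/= mxE floor_itv.
    move=> [+ Dt]; move=> mt; split => //; apply/rowP => j; rewrite mxE.
    have [_] := mt j I; rewrite /= in_itv/= => xm.
    by apply/eqP; rewrite floor_eq.
  apply: measurableI => //.
  apply: fin_bigcap_measurable => // j _.
  have : measurable_fun D (fun t => x t ord0 j * k.+1%:R) by exact: measurable_funM.
  by apply => //; exact: measurable_itv.
rewrite (_ : _ `&` _ = \bigcup_(m in [set: 'rV[int]_n])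
    ((D `&` [set t | cell k (x t) = m]) `&` (D `&` F ^~ (grid k m) @^-1` B))); last first.
  apply/seteqP; split => t /=.
    by move=> [Dt Bt]; exists (cell k (x t)).
  by move=> [m _ [[Dt <-] [_ Bt]]].
apply: countable_bigcupT_measurable; first exact: countableP.
by move=> m; apply: measurableI => //; exact: mF.
Qed.

End caratheodory_function.

(** * Sequences with geometrically decreasing increments *)

Section geometric.
Context {R : realType}.
Implicit Types (u : nat -> R) (a b E : R).

Lemma le_of_geometric_error a b E : (forall k, a <= b + E / 2 ^+ k) -> a <= b.
Proof.
move=> H; apply/ler_addgt0Pr => e e0.
have [E0|E0] := leP E 0.
  by have := H 0%N; rewrite expr0 divr1; lra.
have := near_infty_natSinv_expn_lt (PosNum (divr_gt0 e0 E0)).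
move=> [k _ /(_ k (leqnn k))] /=.
rewrite ltr_pdivlMr// => lt; apply: le_trans (H k) _.
by rewrite lerD2l; apply: ltW; rewrite mulrC -[_^-1]mul1r.
Qed.

Lemma cvg_geometric_error u a E : (forall k, `|u k - a| <= E / 2 ^+ k) ->
  u k @[k --> \oo] --> a.
Proof.
move=> uE; apply/cvgrPdist_lt => e e0.
have E0 : 0 <= E by have := le_trans (normr_ge0 _) (uE 0%N); rewrite expr0 divr1.
have E1 : 0 < E + 1 by rewrite ltr_wpDl.
near=> k; rewrite distrC (le_lt_trans (uE k))//.
apply: (@le_lt_trans _ _ ((E + 1) * (1 / 2 ^+ k))).
  by rewrite mul1r ler_wpM2r ?invr_ge0 ?exprn_ge0// lerDl.
rewrite mulrC -ltr_pdivlMr//.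
by near: k; exact: (near_infty_natSinv_expn_lt (PosNum (divr_gt0 e0 E1))).
Unshelve. all: by end_near. Qed.

(** The sequences u k - 2 E / 2^k and u k + 2 E / 2^k are monotone and enclose
    the limit, which is obtained as a supremum. *)
Lemma geometric_limit u E : (forall k, `|u k.+1 - u k| <= E / 2 ^+ k) ->
  exists l, forall k, `|u k - l| <= 2 * E / 2 ^+ k.
Proof.
move=> uE.
have half k : 2 * E / 2 ^+ k.+1 = E / 2 ^+ k :> R.
  by rewrite exprS; field; rewrite expf_neq0.
have E0 : 0 <= E by have := le_trans (normr_ge0 _) (uE 0%N); rewrite expr0 divr1.
pose w k := u k - 2 * E / 2 ^+ k; pose v k := u k + 2 * E / 2 ^+ k.
have wS k : w k <= w k.+1.
  have := uE k; rewrite /w half -mulrA ler_norml => /andP[].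
  by set e := E / _; lra.
have vS k : v k.+1 <= v k.
  have := uE k; rewrite /v half -mulrA ler_norml => /andP[].
  by set e := E / _; lra.
have ndw : {homo w : k m / (k <= m)%N >-> k <= m}.
  exact: (homo_leq (@lexx _ _) (@le_trans _ _)).
have niv : {homo v : k m / (k <= m)%N >-> m <= k}.
  apply: (homo_leq (r := fun a b => b <= a)) => // a b c ba cb.
  exact: le_trans cb ba.
have wv k m : w k <= v m.
  apply: (le_trans (ndw k (maxn k m) (leq_maxl _ _))).
  apply: le_trans (niv m (maxn k m) (leq_maxr _ _)).
  by rewrite /w /v lerD2l ge0_cp// mulr_ge0 ?mulr_ge0// invr_ge0 exprn_ge0.
exists (sup (range w)) => k.
have wl : w k <= sup (range w).
  by apply: ub_le_sup; [exists (v 0%N) => _ [m _ <-]|exists k].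
have lv : sup (range w) <= v k.
  by apply: ge_sup; [exists (w 0%N), 0%N|move=> _ [m _ <-]].
by rewrite ler_distlC; rewrite /w /v in wl lv; lra.
Qed.

End geometric.

(** * Picard iteration *)

Section rv_box.
Context {R : realType} {n : nat}.
Implicit Types (v w : 'rV[R]_n) (B : R).

Lemma enorm_le_box v B : (forall j, `|v ord0 j| <= B) -> enorm v <= n%:R * B.
Proof.
move=> vB; apply: (le_trans (enorm_le_sum v)).
by rewrite mulr_natl -[n in leRHS]card_ord -sumr_const ler_sum.
Qed.

End rv_box.

Section picard.
Context {R : realType} {n : nat}.
Variables (alpha T : R) (f : R -> 'rV[R]_n -> 'rV[R]_n).
Hypotheses (alpha01 : 0 < alpha < 1) (T0 : 0 < T).
Hypothesis f1 : forall x : 'rV[R]_n, vmeasurable_fun `[0, T] (fun t => f t x).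
Hypothesis f2 : forall r : R, 0 <= r ->
  exists2 lambda : R, 0 < lambda &
    forall t (x y : 'rV[R]_n), t \in `[0, T] -> eball r x -> eball r y ->
      enorm (f t x - f t y) <= lambda * enorm (x - y).
Hypothesis f3 : exists2 c : R, 0 < c &
  forall t (x : 'rV[R]_n), t \in `[0, T] -> enorm (f t x) <= (1 + enorm x) * c.
Implicit Types (x z : R -> 'rV[R]_n) (v w : 'rV[R]_n) (B D L M lam : R).

(** The factor n that compares the Euclidean norm with the coordinates is absorbed
    in [L]. *)
Lemma lipschitz_box B : exists2 L, 0 <= L &
  forall t v w D, t \in `[0, T] ->
    (forall j, `|v ord0 j| <= B) -> (forall j, `|w ord0 j| <= B) ->
    (forall j, `|v ord0 j - w ord0 j| <= D) ->
    forall i, `|f t v ord0 i - f t w ord0 i| <= L * D.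
Proof.
have [lambda lambda0 lip] := f2 (normr_ge0 (n%:R * B)).
exists (lambda * n%:R) => [|t v w D tT vB wB vwD i]; first by rewrite mulr_ge0// ltW.
have in_ball (u : 'rV[R]_n) : (forall j, `|u ord0 j| <= B) -> eball `|n%:R * B| u.
  by move=> uB; rewrite /eball/= (le_trans (enorm_le_box uB))// ler_norm.
have := abs_le_enorm (f t v - f t w) i; rewrite !mxE => /le_trans; apply.
rewrite (le_trans (lip t v w tT (in_ball _ vB) (in_ball _ wB)))//.
rewrite -mulrA ler_pM2l//; apply: enorm_le_box => j.
by rewrite !mxE.
Qed.

Lemma growth_box : exists2 C, 0 < C &
  forall t v B, t \in `[0, T] -> (forall j, `|v ord0 j| <= B) ->
    forall i, `|f t v ord0 i| <= C * (1 + B).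
Proof.
have [c c0 fc] := f3.
exists ((1 + n%:R) * c) => [|t v B tT vB i]; first by rewrite mulr_gt0// ltr_pwDl.
have B0 : 0 <= B by exact: le_trans (vB i).
rewrite (le_trans (abs_le_enorm _ _))// (le_trans (fc _ _ tT))//.
rewrite mulrAC ler_pM2r//.
rewrite (@le_trans _ _ (1 + n%:R * B))// ?lerD2l ?enorm_le_box//.
have n0 : 0 <= n%:R :> R by [].
by move: B0 n0; set m : R := n%:R; lra.
Qed.

(** Bounded by the growth condition, and measurable because the Lipschitz
    condition makes f (t, .) continuous. *)
Lemma Linfty_nemytskii x B : vmeasurable_fun `[0, T] x ->
  (forall t, t \in `[0, T] -> forall j, `|x t ord0 j| <= B) ->
  Linfty T (fun t => f t (x t)).
Proof.
move=> mx xB; split; last first.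
  have [c c0 fc] := f3; exists ((1 + n%:R * B) * c); apply: aeW => t tT.
  by rewrite (le_trans (fc _ _ tT))// ler_pM2r// lerD2l enorm_le_box//; exact: xB.
move=> i; apply: (measurable_caratheodory (X := lebT R)
  (F := fun (t : lebT R) v => f t v ord0 i) (x := fun t : lebT R => x t)).
- exact: borel_lebesgue_measurable.
- by move=> v; exact: f1.
- exact: mx.
move=> t tT.
have [L L0 lip] := lipschitz_box (B + 1).
move=> A /= /nbhs_ballP[e /= e0 eA].
have d0 : 0 < Num.min 1 (e / (L + 1)).
  by rewrite lt_min ltr01/= divr_gt0// ltr_pwDr.
apply/nbhs_ballP; exists (Num.min 1 (e / (L + 1))) => //= v [_ xv].
have vd j : `|x t ord0 j - v ord0 j| < Num.min 1 (e / (L + 1)) by exact: xv.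
have vd1 j : `|x t ord0 j - v ord0 j| < 1 by have := vd j; rewrite lt_min => /andP[].
have vde j : `|x t ord0 j - v ord0 j| <= e / (L + 1).
  by have := vd j; rewrite lt_min => /andP[_ /ltW].
apply: eA; rewrite /ball/=; apply: (le_lt_trans (lip t (x t) v _ tT _ _ vde i)).
- by move=> j; rewrite (le_trans (xB t tT j))// lerDl.
- move=> j; rewrite -[v ord0 j](subKr (x t ord0 j)) (le_trans (ler_normB _ _))//.
  by rewrite lerD ?xB// ltW.
by rewrite mulrCA gtr_pMr// ltr_pdivrMr ?ltr_pwDr// mul1r ltrDl.
Qed.

Lemma small_weight C : exists2 lam, 0 < lam & C * lam `^ (- alpha) <= 1 / 2.
Proof.
have [a0 _] := andP alpha01.
have D0 : 0 < 2 * `|C| + 1 by rewrite ltr_wpDl// mulr_ge0.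
exists ((2 * `|C| + 1) `^ alpha^-1); first exact: powR_gt0.
rewrite -powRrM mulrN mulVf ?gt_eqF// (powR_inv1 (ltW D0)).
rewrite ler_pdivrMr//; have := ler_norm C; lra.
Qed.

Lemma RL_integral_diff_le M lam (phi psi : R -> 'rV[R]_n) i t :
  0 <= M -> 0 < lam -> t \in `[0, T] -> Linfty T phi -> Linfty T psi ->
  {ae leb R, forall s : R, s \in `[0, T] ->
     `|phi s ord0 i - psi s ord0 i| <= M * expR (lam * s)} ->
  `|RL_integral alpha phi t ord0 i - RL_integral alpha psi t ord0 i| <=
    M * lam `^ (- alpha) * expR (lam * t).
Proof.
move=> M0 lam0 tT Lphi Lpsi H.
rewrite (RL_integralB alpha01 i Lphi Lpsi tT); apply: (RL_integral_le alpha01 M0 lam0 tT).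
  move=> j; apply: (@eq_measurable_fun _ _ _ _ _
    (fun t : lebT R => phi t ord0 j - psi t ord0 j)).
    by move=> s _; rewrite !mxE.
  by apply: measurable_funB; [exact: Lphi.1|exact: Lpsi.1].
by move: H; apply: ae_leb_impl => s H sT; rewrite !mxE; exact: H.
Qed.

Definition picard (x0 : 'rV[R]_n) x t : 'rV[R]_n :=
  x0 + RL_integral alpha (fun s => f s (x s)) t.

Lemma picardE (x0 : 'rV[R]_n) x t j : picard x0 x t ord0 j =
  x0 ord0 j + RL_integral alpha (fun s => f s (x s)) t ord0 j.
Proof. by rewrite /picard [LHS]mxE. Qed.

Lemma expR_weight_le M lam t : 0 <= M -> 0 < lam -> t \in `[0, T] ->
  M * expR (lam * t) <= M * expR (lam * T).
Proof.
by move=> M0 l0; rewrite in_itv/= => /andP[_ tT]; rewrite ler_wpM2l// ler_expR ler_pM2l.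
Qed.

Lemma expR_weight_ge1 lam t : 0 < lam -> t \in `[0, T] -> 1 <= expR (lam * t).
Proof.
move=> l0; rewrite in_itv/= => /andP[t0 _].
by rewrite -expR0 ler_expR mulr_ge0// ltW.
Qed.

Lemma measurable_picard (x0 : 'rV[R]_n) x B : vmeasurable_fun `[0, T] x ->
  (forall t, t \in `[0, T] -> forall j, `|x t ord0 j| <= B) ->
  vmeasurable_fun `[0, T] (picard x0 x).
Proof.
move=> mx xB i; have Lf := Linfty_nemytskii mx xB.
apply: (@eq_measurable_fun _ _ _ _ _ (fun t : lebT R => x0 ord0 i +
    RL_integral alpha (fun s => f s (x s)) t ord0 i)).
  by move=> t _; rewrite picardE.
exact: (measurable_funD (measurable_cst _) (measurable_RL_integral alpha01 Lf i)).
Qed.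

(** If C is the growth constant and C lam^(- alpha) <= 1 / 2, then the bound [M] is
    sent to |x0| + (1 + M) / 2, which is at most [M] for M = 2 |x0| + 1. *)
Lemma picard_invariant (x0 : 'rV[R]_n) : exists M lam, [/\ 0 <= M, 0 < lam,
  forall j, `|x0 ord0 j| <= M &
  forall x, vmeasurable_fun `[0, T] x ->
    (forall t, t \in `[0, T] -> forall j, `|x t ord0 j| <= M * expR (lam * t)) ->
    forall t, t \in `[0, T] -> forall j,
      `|picard x0 x t ord0 j| <= M * expR (lam * t)].
Proof.
have [C C0 fC] := growth_box; have [lam lam0 Clam] := small_weight C.
pose A := enorm x0; have A0 : 0 <= A by exact: sqrtr_ge0.
exists (2 * A + 1), lam; split => //.
- by rewrite addr_ge0// mulr_ge0.
- by move=> j; rewrite (le_trans (abs_le_enorm _ _))// -/A; lra.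
move=> x mx xM t tT j; set M := 2 * A + 1.
have M0 : 0 <= M by rewrite addr_ge0// mulr_ge0.
have e1 := expR_weight_ge1 lam0 tT.
have Lf : Linfty T (fun s => f s (x s)).
  apply: (Linfty_nemytskii (B := M * expR (lam * T))) => // s sT i.
  by rewrite (le_trans (xM s sT i))// expR_weight_le.
have := @RL_integral_le _ _ _ _ alpha01 (C * (1 + M)) lam
  (fun s => f s (x s)) j t _ lam0 tT Lf.1.
move=> /(_ (mulr_ge0 (ltW C0) (addr_ge0 ler01 M0))) H.
have {}H : `|RL_integral alpha (fun s => f s (x s)) t ord0 j| <=
    C * (1 + M) * lam `^ (- alpha) * expR (lam * t).
  apply: H; apply: aeW => s sT; rewrite (le_trans (fC s _ _ sT (xM s sT) j))//.
  rewrite -mulrA ler_pM2l// [leRHS]mulrDl mul1r lerD2r.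
  exact: (expR_weight_ge1 lam0 sT).
rewrite picardE (le_trans (ler_normD _ _))//.
have x0A : `|x0 ord0 j| <= A * expR (lam * t).
  by rewrite (le_trans (abs_le_enorm _ _))// ler_peMr.
apply: (le_trans (lerD x0A H)); rewrite -mulrDl ler_pM2r ?expR_gt0//.
rewrite mulrAC; have : (1 + M) * (C * lam `^ (- alpha)) <= (1 + M) * (1 / 2).
  by rewrite ler_wpM2l// addr_ge0.
by rewrite mulrC /M; lra.
Qed.

(** Stated for [phi] and [psi] that agree only almost everywhere with f (., x) and
    f (., z), so that it applies both to the iterates and to arbitrary solutions
    of the Cauchy problem. *)
Lemma RL_contraction B : exists2 lam, 0 < lam &
  forall x z (phi psi : R -> 'rV[R]_n) D, 0 <= D ->
    Linfty T phi -> Linfty T psi ->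
    {ae leb R, forall t : R, t \in `[0, T] -> phi t = f t (x t)} ->
    {ae leb R, forall t : R, t \in `[0, T] -> psi t = f t (z t)} ->
    (forall t, t \in `[0, T] -> forall j, `|x t ord0 j| <= B) ->
    (forall t, t \in `[0, T] -> forall j, `|z t ord0 j| <= B) ->
    (forall t, t \in `[0, T] -> forall j,
       `|x t ord0 j - z t ord0 j| <= D * expR (lam * t)) ->
    forall t, t \in `[0, T] -> forall j,
       `|RL_integral alpha phi t ord0 j - RL_integral alpha psi t ord0 j| <=
         D / 2 * expR (lam * t).
Proof.
have [L L0 lip] := lipschitz_box B; have [lam lam0 Llam] := small_weight L.
exists lam => // x z phi psi D D0 Lphi Lpsi phiE psiE xB zB xz t tT j.
apply: (@le_trans _ _ (L * D * lam `^ (- alpha) * expR (lam * t))).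
  apply: RL_integral_diff_le => //; first by rewrite mulr_ge0.
  move: phiE psiE; apply: ae_leb_impl2 => s phiE psiE sT.
  rewrite phiE// psiE// -mulrA; apply: (lip s) => //; [exact: xB|exact: zB|exact: xz].
rewrite ler_pM2r ?expR_gt0// mulrAC mulrC ler_wpM2l//.
by rewrite -[2^-1]mul1r.
Qed.

(** Every iterate stays in the invariant set, on which one Lipschitz constant
    holds; the limit inherits the bound and measurability, and the contraction
    passes the recursion to the limit. *)
Lemma picard_fixed_point (x0 : 'rV[R]_n) : exists x B, [/\ vmeasurable_fun `[0, T] x,
  (forall t, t \in `[0, T] -> forall j, `|x t ord0 j| <= B) &
  forall t, t \in `[0, T] -> x t = picard x0 x t].
Proof.
have [M [lam [M0 lam0 x0M inv]]] := picard_invariant x0.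
pose u k := iter k (picard x0) (fun=> x0).
pose B := M * expR (lam * T).
have B0 : 0 <= B by rewrite mulr_ge0 ?expR_ge0.
have weightB z : (forall t, t \in `[0, T] ->
      forall j, `|z t ord0 j| <= M * expR (lam * t)) ->
    forall t, t \in `[0, T] -> forall j, `|z t ord0 j| <= B.
  by move=> zM t tT j; rewrite (le_trans (zM t tT j))// expR_weight_le.
have uP k : vmeasurable_fun `[0, T] (u k) /\
    forall t, t \in `[0, T] -> forall j, `|u k t ord0 j| <= M * expR (lam * t).
  elim: k => [|k [mu_ uM]].
    split; first by move=> i; exact: measurable_cst.
    by move=> t tT j; rewrite (le_trans (x0M j))// ler_peMr// expR_weight_ge1.
  split; first exact: measurable_picard (weightB _ uM).
  exact: inv.
have uB k := weightB _ (uP k).2.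
have Lu k : Linfty T (fun s => f s (u k s)).
  exact: Linfty_nemytskii (uP k).1 (uB k).
have [lam' lam'0 contr] := RL_contraction B.
(* Two functions bounded by B differ by at most 2 B. *)
pose D := 2 * B; have D0 : 0 <= D by rewrite mulr_ge0.
have half (E : R) k : E / 2 ^+ k / 2 = E / 2 ^+ k.+1.
  by rewrite exprSr invfM mulrA.
have pow0 k : 0 <= (2 ^+ k)^-1 :> R by rewrite invr_ge0 exprn_ge0.
have picardB x z t j : picard x0 x t ord0 j - picard x0 z t ord0 j =
    RL_integral alpha (fun s => f s (x s)) t ord0 j -
    RL_integral alpha (fun s => f s (z s)) t ord0 j.
  by rewrite !picardE opprD addrACA subrr add0r.
have du k t : t \in `[0, T] -> forall j,
    `|u k.+1 t ord0 j - u k t ord0 j| <= D / 2 ^+ k * expR (lam' * t).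
  elim: k t => [|k IH] t tT j.
    rewrite expr0 divr1 (le_trans (ler_normB _ _))//.
    rewrite (@le_trans _ _ D)// ?ler_peMr ?expR_weight_ge1//.
    by rewrite /D mulr_natl mulr2n lerD ?uB.
  rewrite /= picardB -half.
  apply: (contr (u k.+1) (u k)) => //; try exact: aeW.
  - by rewrite mulr_ge0.
  - exact: (Lu k.+1).
  - exact: (uB k.+1).
  - exact: (uB k).
have limE (t : R) : exists v : 'rV[R]_n, t \in `[0, T] -> forall j k,
    `|u k t ord0 j - v ord0 j| <= 2 * (D * expR (lam' * t)) / 2 ^+ k.
  have [tT|_] := boolP (t \in `[0, T]); last by exists 0.
  have /choice[l lP] j := @geometric_limit _ (fun k => u k t ord0 j) (D * expR (lam' * t))
     (fun k => eq_rect _ (fun e => _ <= e) (du k t tT j) _ (mulrAC _ _ _)).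
  by exists (\row_j l j) => _ j k; rewrite mxE.
have [x xP] := choice limE.
have xB t : t \in `[0, T] -> forall j, `|x t ord0 j| <= B.
  move=> tT j; apply: (@le_of_geometric_error _ _ _ (2 * (D * expR (lam' * t)))) => k.
  rewrite -[x t ord0 j](subKr (u k t ord0 j)) (le_trans (ler_normB _ _))//.
  by rewrite lerD// ?uB//; exact: xP.
have mx : vmeasurable_fun `[0, T] x.
  move=> j; apply: (measurable_fun_cvg (h := fun k (t : lebT R) => u k t ord0 j)).
    by move=> k; exact: (uP k).1.
  by move=> t tT; apply: cvg_geometric_error; exact: xP.
exists x, B; split => // t tT; apply/rowP => j; apply/eqP.
rewrite -subr_eq0 -normr_le0.
apply: (@le_of_geometric_error _ _ _ (2 * (D * expR (lam' * t)))) => k; rewrite add0r.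
have Lx : Linfty T (fun s => f s (x s)) by exact: Linfty_nemytskii mx xB.
have E1 : `|picard x0 (u k) t ord0 j - picard x0 x t ord0 j| <=
    (2 * D / 2 ^+ k) / 2 * expR (lam' * t).
  rewrite picardB; apply: (contr (u k) x) => //; try exact: aeW.
  - by rewrite !mulr_ge0.
  - exact: (uB k).
  move=> s sT i; rewrite (le_trans (xP s sT i k))//.
  by rewrite mulrA mulrAC.
have E2 := xP t tT j k.+1.
have telescope (a b c : R) : b - c = (a - c) - (a - b) by ring.
rewrite (telescope (picard x0 (u k) t ord0 j)).
rewrite (le_trans (ler_normB _ _))// (le_trans (lerD E1 E2))//.
rewrite le_eqVlt; apply/orP; left; apply/eqP; rewrite exprS.
by field; rewrite expf_neq0.
Qed.

End picard.

(** * Solutions of the Cauchy problem *)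

Section solutions.
Context {R : realType} {n : nat}.
Variables (alpha T : R) (f : R -> 'rV[R]_n -> 'rV[R]_n).
Hypotheses (alpha01 : 0 < alpha < 1) (T0 : 0 < T).
Implicit Types (z phi : R -> 'rV[R]_n).

(** The Volterra form of the problem; both directions follow from
    [caputo_derivativeE]. *)
Lemma cauchy_solutionP (x0 : 'rV[R]_n) z : cauchy_solution alpha T f x0 z <->
  exists phi, [/\ Linfty T phi,
    {ae leb R, forall t : R, t \in `[0, T] -> phi t = f t (z t)} &
    forall t, t \in `[0, T] -> z t = x0 + RL_integral alpha phi t].
Proof.
split => [[[y [phi Lphi yE] zE] sol]|[phi [Lphi phiE zE]]].
  have {}zE t : t \in `[0, T] -> z t = x0 + RL_integral alpha phi t.
    by move=> tT; rewrite zE// yE.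
  exists phi; split => //.
  move: (caputo_derivativeE alpha01 T0 Lphi zE) sol.
  by apply: ae_leb_impl2 => t D sol tT; rewrite -(D tT).2; exact: (sol tT).2.
split; first by exists (RL_integral alpha phi) => //; exists phi.
move: (caputo_derivativeE alpha01 T0 Lphi zE) phiE.
by apply: ae_leb_impl2 => t D phiE tT; rewrite -phiE//; exact: D.
Qed.

(** Solutions are bounded a priori because they are fractional integrals of
    essentially bounded functions; this is what makes the local Lipschitz
    condition available in the proof of uniqueness. *)
Lemma bounded_solution (x0 : 'rV[R]_n) phi : Linfty T phi -> exists B,
  forall t, t \in `[0, T] -> forall j,
    `|(x0 + RL_integral alpha phi t) ord0 j| <= B.
Proof.
move=> Lphi; have [C C0 repr] := Linfty_representative Lphi.
exists (enorm x0 + C * 1 `^ (- alpha) * expR (1 * T)) => t tT j.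
rewrite mxE (le_trans (ler_normD _ _))// lerD ?abs_le_enorm//.
have phiC : {ae leb R, forall s : R, s \in `[0, T] ->
    `|phi s ord0 j| <= C * expR (1 * s)}.
  have [h [_ _ hphi] hC] := repr j; move: hphi.
  by apply: ae_leb_impl => s hphi sT; rewrite -hphi.
rewrite (le_trans (RL_integral_le alpha01 C0 ltr01 tT Lphi.1 phiC))//.
by apply: expR_weight_le => //; rewrite mulr_ge0 ?powR_ge0.
Qed.

End solutions.

Theorem theorem2p1 (R : realType) (n : nat) (alpha T : R)
    (f : R -> 'rV[R]_n -> 'rV[R]_n)
    (alpha01 : 0 < alpha < 1) (T_gt0 : 0 < T)
    (f1 : forall x : 'rV[R]_n, vmeasurable_fun `[0, T] (fun t => f t x))
    (f2 : forall r : R, 0 <= r ->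
      exists2 lambda : R, 0 < lambda &
        forall t (x y : 'rV[R]_n), t \in `[0, T] -> eball r x -> eball r y ->
          enorm (f t x - f t y) <= lambda * enorm (x - y))
    (f3 : exists2 c : R, 0 < c &
        forall t (x : 'rV[R]_n), t \in `[0, T] ->
          enorm (f t x) <= (1 + enorm x) * c)
    (x0 : 'rV[R]_n) :
  exists2 x : R -> 'rV[R]_n, cauchy_solution alpha T f x0 x &
    forall z : R -> 'rV[R]_n, cauchy_solution alpha T f x0 z ->
      forall t, t \in `[0, T] -> z t = x t.
Proof.
have [x [B [mx xB xE]]] := picard_fixed_point alpha01 f1 f2 f3 x0.
have Lx : Linfty T (fun s => f s (x s)) by exact: (Linfty_nemytskii f1 f2 f3 mx xB).
exists x.
  apply/(cauchy_solutionP f alpha01 T_gt0).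
  by exists (fun s => f s (x s)); split => //; exact: aeW.
move=> z /(cauchy_solutionP f alpha01 T_gt0)[phi [Lphi phiE zE]].
have [Bz zB] := bounded_solution alpha01 x0 Lphi.
(* One box for both solutions, since the Lipschitz constant depends on it. *)
pose B' := `|B| + `|Bz|; have B'0 : 0 <= B' by rewrite addr_ge0.
have xB' t : t \in `[0, T] -> forall j, `|x t ord0 j| <= B'.
  by move=> tT j; rewrite (le_trans (xB t tT j))// (le_trans (ler_norm _))// lerDl.
have zB' t : t \in `[0, T] -> forall j, `|z t ord0 j| <= B'.
  move=> tT j; rewrite zE// (le_trans (zB t tT j))// (le_trans (ler_norm _))//.
  by rewrite lerDr.
have [lam lam0 contr] := RL_contraction alpha01 f2 B'.
pose D := 2 * B'; have D0 : 0 <= D by rewrite mulr_ge0.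
have close k : forall t, t \in `[0, T] -> forall j,
    `|z t ord0 j - x t ord0 j| <= D / 2 ^+ k * expR (lam * t).
  elim: k => [|k IH] t tT j.
    rewrite expr0 divr1 (le_trans (ler_normB _ _))//.
    rewrite (@le_trans _ _ D)// ?ler_peMr ?(expR_weight_ge1 lam0 tT)//.
    by rewrite /D mulr_natl mulr2n lerD// ?zB'// xB'.
  have -> : z t ord0 j - x t ord0 j = RL_integral alpha phi t ord0 j -
      RL_integral alpha (fun s => f s (x s)) t ord0 j.
    have := picardE alpha f x0 x t j; rewrite -xE// => ->.
    by rewrite zE// [X in X - _]mxE opprD addrACA subrr add0r.
  rewrite exprSr invfM mulrA.
  apply: (contr z x) => //; last exact: aeW.
  by rewrite mulr_ge0// invr_ge0 exprn_ge0.
move=> t tT; apply/rowP => j; apply/eqP; rewrite -subr_eq0 -normr_le0.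
apply: (@le_of_geometric_error _ _ _ (D * expR (lam * t))) => k.
by rewrite add0r mulrAC; exact: close.
Qed.
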